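(* If there is no pair of integers $i\ge 1$ and $j\ge 1$ such that $2^{ir}(2^{jr}-1)=1$, then $\psi(3)<\infty$; otherwise, $\psi(3)=\infty$.
   Context: Fix a rate $r\in[0,1]$. For $x^n\in\{0,1\}^n$ let $\ell(x^n)=(1-2^{-r})\sum_{i=1}^n x_i2^{ir}$ and $m(x^n)=\lceil\ell(x^n)\rceil$; words with the same value of $m$ form a coset of the length-$n$, rate-$r$ overlapped arithmetic code. For $0\le d\le n$ let $k(x^n,d)$ be the number of $y^n\in\{0,1\}^n$ with $m(y^n)=m(x^n)$ and Hamming distance $d$ from $x^n$. The Hamming distance spectrum of the code (uniform binary source) is $\psi(d;n)=2^{-n}\sum_{x^n\in\{0,1\}^n}k(x^n,d)$, and the asymptotic Hamming distance spectrum is $\psi(d)=\lim_{n\to\infty}\psi(d;n)$.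
   Formalization: The rate r = 0 is excluded: there all words lie in one coset, so ψ(3;n) = C(n,3) tends to infinity although no pair (i, j) satisfies the equation, and the claim is false; all rates 0 < r ≤ 1 are covered. *)

(* Defs.v *)
From HB Require Import structures.
From mathcomp Require Import all_boot all_order all_algebra.
From mathcomp Require Import all_classical all_reals all_analysis.

Set Implicit Arguments.
Unset Strict Implicit.
Unset Printing Implicit Defensive.

Import Order.TTheory GRing.Theory Num.Theory.
Import numFieldNormedType.Exports.

Local Open Scope classical_set_scope.
Local Open Scope ring_scope.

(* Overlapped arithmetic codes of rate r.  Positions are indexed by 'I_n from
   0, so position i : 'I_n carries the weight 2 ^ ((i + 1) r). *)

Definition oac_ell (R : realType) (r : R) (n : nat) (x : n.-tuple bool) : R :=
  (1 - 2 `^ (- r)) *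
    \sum_(i < n) (nat_of_bool (tnth x i))%:R * 2 `^ ((i.+1)%:R * r).

Definition oac_m (R : realType) (r : R) (n : nat) (x : n.-tuple bool) : int :=
  Num.ceil (oac_ell r x).

Definition hamming_dist (n : nat) (x y : n.-tuple bool) : nat :=
  #|[set i : 'I_n | tnth x i != tnth y i]%SET|.

Definition oac_k (R : realType) (r : R) (n : nat) (x : n.-tuple bool)
    (d : nat) : nat :=
  #|[set y : n.-tuple bool |
      (oac_m r y == oac_m r x) && (hamming_dist x y == d)]%SET|.

Definition hds_n (R : realType) (r : R) (d n : nat) : R :=
  2 ^- n * \sum_(x : n.-tuple bool) (oac_k r x d)%:R.

(* The limit is taken in the extended reals, where it may be +oo.  lim is a
   total operator with an arbitrary value on divergent sequences, so claims
   about hds r d are meaningful only together with convergence of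
   n |-> (hds_n r d n)%:E. *)
Definition hds (R : realType) (r : R) (d : nat) : \bar R :=
  lim ((hds_n r d n)%:E @[n --> \oo]).

(* Main.v *)
Require Import Defs.
From HB Require Import structures.
From mathcomp Require Import all_boot all_order all_algebra.
From mathcomp Require Import all_classical all_reals all_analysis.
From mathcomp Require Import ring lra zify.

Set Implicit Arguments.
Unset Strict Implicit.
Unset Printing Implicit Defensive.

Import Order.TTheory GRing.Theory Num.Theory.
Import numFieldNormedType.Exports.

Local Open Scope classical_set_scope.
Local Open Scope ring_scope.

(* Write a = 2^r and let the position i (from 0) carry the weight
   w_i = (1 - 1/a) a^(i+1).  Up to a power of a, the difference of two words at
   distance 3 is +-1 +- a^p +- a^q with 0 < p < q.  If a^q = a^p + 1 has a
   solution, every shift of the corresponding pattern gives a positive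
   proportion of pairs with equal ell, so psi(3;n) grows at least linearly.
   Otherwise |ell x - ell y| >= 1 as soon as the last differing position is at
   least some K, so psi(3; K + l) is a fixed finite combination of the means
   E 1[ceil (s + Z_l) = ceil (t + Z_l)], with Z_l = sum_(K <= i < K + l) b_i w_i
   for independent fair bits b_i, and these means have to be shown to converge.
   - Fourier coefficients: E cos (2 pi h Z_l + p) =
     cos (p + pi sum e_i) prod cos (pi e_i), where e_i is the signed distance
     of h w_i to the nearest integer.  Either the product tends to 0, or
     sum e_i^2 < oo; then a is algebraic by Pisot's argument (Hankel
     determinants of the nearest integers vanish) and e_i satisfies a linear
     recurrence, which forces sum e_i to converge.
   - No concentration: unless a is an integer (then all w_i are integers and
     the mean is constant), the w_i take infinitely many values mod 1, hence
     2^k distinct subset sums can be extracted for every k.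
   - The indicator is a step function of a cosine, approximated by polynomials
     in that cosine away from the jumps, and the jumps carry little mass. *)

(** * Hadamard's inequality and Kronecker's criterion *)

Lemma gram_diag_ge0 (R : realFieldType) (k n : nat) (B : 'M[R]_(k, n)) i :
  0 <= (B *m B^T) i i.
Proof.
by rewrite mxE sumr_ge0// => j _; rewrite mxE -expr2 sqr_ge0.
Qed.

(** One step of Gram-Schmidt: subtracting from the other rows their projections on the first row [v]
    keeps the Gram determinant, makes it factor, and can only shorten those rows. *)
Lemma gram_hadamard (R : realFieldType) (k n : nat) (B : 'M[R]_(k, n)) :
  \det (B *m B^T) <= \prod_i (B *m B^T) i i.
Proof.
elim: k B => [|k IH] B; first by rewrite det_mx00 big_ord0.
rewrite -[k.+1]/(1 + k)%N in B *.
pose v := usubmx B; pose C := dsubmx B.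
pose s := (v *m v^T) 0 0.
have vvs : v *m v^T = s%:M by apply/matrixP => i j; rewrite !ord1 !mxE /s !mxE.
have s0 : 0 <= s := gram_diag_ge0 v 0.
pose w : 'cV_k := s^-1 *: (C *m v^T); pose D := C - w *m v.
have Dv : D *m v^T = 0.
  rewrite /D mulmxBl -mulmxA vvs mul_mx_scalar /w scalerA.
  (* If [s = 0] then [s^-1] is 0 by convention, but [v] itself vanishes and orthogonality is
     trivial. *)
  have [s00|/mulfV ->] := eqVneq s 0; last by rewrite scale1r subrr.
  suff -> : v = 0 by rewrite trmx0 mulmx0 scaler0 subrr.
  apply/matrixP => i j; rewrite ord1 [RHS]mxE; apply/eqP.
  have /eqP := s00; rewrite /s mxE psumr_eq0 => [/allP/(_ j)|l _].
    by rewrite mem_index_enum => /(_ isT) /=; rewrite [v^T j 0]mxE -expr2 sqrf_eq0.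
  by rewrite [v^T _ _]mxE -expr2 sqr_ge0.
have vD : v *m D^T = 0 by rewrite -[v]trmxK -trmx_mul Dv trmx0.
have CE : C = w *m v + D by rewrite /D addrC subrK.
have DD : D *m D^T = D *m C^T.
  rewrite CE [X in _ = _ *m X]linearD /= [X in _ = _ *m (X + _)]trmx_mul.
  by rewrite mulmxDr mulmxA Dv mul0mx add0r.
pose L : 'M[R]_(1 + k) := block_mx 1%:M 0 w 1%:M.
have BE : B = L *m col_mx v D.
  by rewrite mul_block_col !mul1mx mul0mx addr0 -CE vsubmxK.
have detL : \det L = 1 by rewrite det_lblock !det1 mulr1.
have -> : \det (B *m B^T) = s * \det (D *m D^T).
  rewrite BE trmx_mul tr_col_mx mulmxA -(mulmxA L) mul_col_row vD Dv.
  rewrite !det_mulmx det_tr detL mul1r mulr1 det_lblock vvs.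
  by rewrite det_scalar1.
rewrite big_split_ord /= big_ord1.
have -> : B *m B^T = block_mx (v *m v^T) (v *m C^T) (C *m v^T) (C *m C^T).
  by rewrite -mul_col_row -tr_col_mx vsubmxK.
rewrite block_mxEul; apply: ler_wpM2l => //.
apply: le_trans (IH D) _; apply: ler_prod => i _.
rewrite gram_diag_ge0 block_mxEdr DD /D mulmxBl [_ i i]mxE [X in _ + X]mxE.
rewrite gerBl -mulmxA mxE big_ord1 mxE.
have -> : (v *m C^T) 0 i = (C *m v^T) i 0.
  by rewrite -[v]trmxK -trmx_mul mxE trmxK.
by rewrite -mulrA mulr_ge0 ?invr_ge0// -expr2 sqr_ge0.
Qed.

Lemma hadamard (R : realFieldType) (n : nat) (A : 'M[R]_n) :
  (\det A) ^+ 2 <= \prod_i \sum_j A i j ^+ 2.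
Proof.
have := gram_hadamard A; rewrite det_mulmx det_tr -expr2 => /le_trans.
by apply; rewrite le_eqVlt; apply/orP; left; apply/eqP/eq_bigr => i _;
  rewrite mxE; apply: eq_bigr => j _; rewrite mxE expr2.
Qed.

(** * Polynomials in the shift operator and Hankel matrices *)

Section PolyAct.
Variable R : fieldType.
Implicit Types (p q : {poly R}) (s : nat -> R).

(* The operator p(S), where S is the shift on sequences. *)
Definition shift_poly p s (e : nat) : R := \sum_(j < size p) p`_j * s (e + j)%N.

Lemma shift_polyE n p s e : (size p <= n)%N ->
  shift_poly p s e = \sum_(j < n) p`_j * s (e + j)%N.
Proof.
move=> pn; rewrite /shift_poly (big_ord_widen n (fun j => p`_j * s (e + j)%N))//.
rewrite big_mkcond; apply: eq_bigr => i _.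
by case: ltnP => // pi; rewrite nth_default// mul0r.
Qed.

Lemma shift_poly_comm p q s e :
  shift_poly p (shift_poly q s) e = shift_poly q (shift_poly p s) e.
Proof.
rewrite /shift_poly; under eq_bigr do rewrite mulr_sumr.
rewrite exchange_big; apply: eq_bigr => i _; rewrite mulr_sumr.
by apply: eq_bigr => j _; rewrite mulrCA -!addnA [(j + i)%N]addnC.
Qed.

Lemma shift_poly_mulX1 p s e :
  shift_poly (p * ('X - 1)) s e = shift_poly p s e.+1 - shift_poly p s e.
Proof.
have [->|p0] := eqVneq p 0.
  by rewrite mul0r /shift_poly size_poly0 !big_ord0 subr0.
rewrite (@shift_polyE (size p).+1); last first.
  by rewrite (leq_trans (size_polyMleq _ _))// -polyC1 size_XsubC; lia.
rewrite (@shift_polyE (size p).+1 p s e)//.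
under eq_bigr do rewrite mulrBr mulr1 coefB coefMX mulrBl.
rewrite sumrB big_ord_recl /= mul0r add0r; congr (_ - _).
by apply: eq_bigr => i _; rewrite /bump /= add1n addSnnS.
Qed.

Lemma shift_poly_geom p c a e :
  shift_poly p (fun i => c * a ^+ i) e = p.[a] * (c * a ^+ e).
Proof.
rewrite /shift_poly horner_coef mulr_suml; apply: eq_bigr => i _.
by rewrite exprD; ring.
Qed.

Lemma shift_polyB p s t e :
  shift_poly p (fun i => s i - t i) e = shift_poly p s e - shift_poly p t e.
Proof. by rewrite /shift_poly -sumrB; apply: eq_bigr => i _; rewrite mulrBr. Qed.

Definition hankel s n : 'M[R]_n := \matrix_(i, j) s (i + j)%N.

(** Take the entries of a left kernel vector as the coefficients of [p]: entry [i] of its product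
    with the Hankel matrix is p(S)s at [i]. *)
Lemma hankel_ker s n : \det (hankel s n) = 0 ->
  exists p, [/\ p != 0, (size p <= n)%N &
    forall i, (i < n)%N -> shift_poly p s i = 0].
Proof.
move/eqP/det0P => [v v0 vH]; exists (rVpoly v); split.
- by apply: contra v0 => /eqP vp; rewrite -[v]rVpolyK vp linear0.
- by rewrite size_poly.
- move=> i ni; rewrite (@shift_polyE n) ?size_poly//.
  have := congr1 (fun M : 'rV_n => M 0 (Ordinal ni)) vH.
  rewrite !mxE => vHi; rewrite -[RHS]vHi; apply: eq_bigr => j _.
  by rewrite coef_rVpoly_ord mxE addnC.
Qed.

(* Kronecker's criterion.  A polynomial [p] of minimal size in the kernel of the
   Hankel matrix of size [M.+1] annihilates the whole sequence: if [e] is the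
   first failure, take [q] in the kernel of the Hankel matrix of size [e.+1] and
   apply [p(S) q(S)] in both orders. *)
Lemma kronecker s M : (forall n, (M < n)%N -> \det (hankel s n) = 0) ->
  exists2 p, p != 0 & forall e, shift_poly p s e = 0.
Proof.
move=> det0.
pose K n p := [/\ p != 0, (size p <= n)%N &
  forall i, (i < n)%N -> shift_poly p s i = 0].
have Kex n : (M < n)%N -> exists p, K n p by move=> /det0/hankel_ker.
have [p Kp pmin] : exists2 p, K M.+1 p &
    forall q, K M.+1 q -> (size p <= size q)%N.
  have [p0 Kp0] := Kex M.+1 (ltnSn _).
  elim: {p0}(size p0) {-2}p0 (leqnn (size p0)) Kp0 => [|n IH] p pn Kp.
    by exists p => // q _; move: pn; rewrite leqn0 => /eqP ->.
  have [[q [Kq qn]]|nq] := EM (exists q, K M.+1 q /\ (size q <= n)%N).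
    exact: IH Kq.
  exists p => // q Kq; rewrite (leq_trans pn)// ltnNge; apply/negP => qn.
  by apply: nq; exists q.
exists p; first by case: Kp.
move=> e; elim/ltn_ind: e => e IHe.
have [p0 pM Kp0] := Kp.
have [|eM] := leqP e M; first by move=> eM; exact: Kp0.
have [q Kq] := Kex e.+1 (ltnW eM); have [q0 qe Kq0] := Kq.
have pq : (size p <= size q)%N.
  have [qM|] := leqP (size q) M.+1; last by move=> /ltnW; exact: leq_trans.
  apply: pmin; split => // i iM; apply: Kq0; rewrite (leq_trans iM)//.
  by rewrite ltnW.
have sq0 : (0 < size q)%N by rewrite size_poly_gt0.
(* As [size p <= size q], p(S)q(S)s at [t] only involves q(S)s at indices up to [e], where it
   vanishes. In the other order [IHe] kills every term but the leading one, which is [lead_coef q]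
   times p(S)s at [e]. *)
pose t := (e.+1 - size q)%N.
have te : (t + (size q).-1 = e)%N by rewrite /t; lia.
have : shift_poly p (shift_poly q s) t = 0.
  rewrite {1}/shift_poly big1// => j _; rewrite Kq0 ?mulr0//.
  by have := ltn_ord j; lia.
rewrite shift_poly_comm (@shift_polyE (size q).-1.+1); last by rewrite prednK.
rewrite big_ord_recr /= big1 ?add0r; last first.
  by move=> j _; rewrite IHe ?mulr0// -[X in (_ < X)%N]te ltn_add2l.
move/eqP; rewrite te mulf_eq0 -lead_coefE lead_coef_eq0 (negbTE q0) /=.
by move/eqP.
Qed.

End PolyAct.

(** * Pisot's theorem *)

Lemma cvg_sum_ord (R : realType) (n : nat) (f : nat -> nat -> R) (l : nat -> R) :
  (forall i, (i < n)%N -> f i @ \oo --> l i) ->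
  (fun m => \sum_(i < n) f i m) @ \oo --> \sum_(i < n) l i.
Proof.
elim: n => [|n IH] fl.
  rewrite big_ord0 (_ : (fun _ => _) = cst 0); first exact: cvg_cst.
  by apply/funext => m; rewrite big_ord0.
rewrite big_ord_recr /= (_ : (fun _ => _) =
   (fun m => \sum_(i < n) f i m + f n m)).
  by apply: cvgD; [apply: IH => i ni; apply: fl; exact: ltnW | exact: fl].
by apply/funext => m; rewrite big_ord_recr.
Qed.

Lemma cvgn_addl (R : realType) (u : nat -> R) (l : R) k :
  u @ \oo --> l -> (fun n => u (n + k)%N) @ \oo --> l.
Proof. by move=> ul; rewrite -(cvg_shiftn k) in ul. Qed.

Lemma expr_gt_near (R : realType) (a : R) (B : R) : 1 < a ->
  exists M, forall m, (M <= m)%N -> B < a ^+ m.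
Proof.
move=> a1.
have a0 : 0 < a by apply: lt_trans a1.
have na : `|a^-1| < 1 by rewrite gtr0_norm ?invr_gt0// invf_lt1.
have B1 : 0 < `|B| + 1 by rewrite ltr_pwDr// ltr01.
have B0 : 0 < (`|B| + 1)^-1 by rewrite invr_gt0.
have /cvgr0Pnorm_lt/(_ _ B0)[M _ HM] := cvg_expr na.
exists M => m /HM /=.
rewrite normrX gtr0_norm ?invr_gt0// exprVn ltf_pV2 ?posrE ?exprn_gt0//.
apply: le_lt_trans; apply: le_trans (ler_norm B) _; rewrite lerDl ler01//.
Qed.

Lemma bounded_sum_tail (R : realType) (f : nat -> R) (S e : R) :
  (forall i, 0 <= f i) -> (forall n, \sum_(i < n) f i <= S) -> 0 < e ->
  exists I, forall i n, (I <= i)%N -> \sum_(j < n) f (i + j)%N <= e.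
Proof.
move=> f0 fS e0.
pose A := range (fun n => \sum_(i < n) f i).
have supA : has_sup A.
  split; first by exists (\sum_(i < 0) f i); exists 0%N.
  by exists S => _ [n _ <-].
have [_ [I _ <-] HI] := sup_adherent e0 supA.
exists I => i n Ii.
have sE m k : \sum_(j < m + k) f j = \sum_(j < m) f j + \sum_(j < k) f (m + j)%N.
  by rewrite big_split_ord.
have : \sum_(j < I + ((i - I) + n)) f j <= sup A.
  by apply: sup_upper_bound => //; exists (I + ((i - I) + n))%N.
rewrite sE big_split_ord /=.
have : 0 <= \sum_(j < i - I) f (I + j)%N by apply: sumr_ge0.
have : \sum_(j < n) f (i + j)%N = \sum_(j < n) f (I + (i - I + j))%N.
  by apply: eq_bigr => j _; rewrite addnA subnKC.
lra.
Qed.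

Lemma bounded_sum_cvg0 (R : realType) (f : nat -> R) (S : R) :
  (forall n, \sum_(i < n) f i ^+ 2 <= S) -> f @ \oo --> 0.
Proof.
move=> fS; apply/cvgr0Pnorm_le => e e0.
have f0 i : 0 <= f i ^+ 2 by exact: sqr_ge0.
have [I HI] := bounded_sum_tail f0 fS (exprn_gt0 2 e0).
exists I => // i /= Ii; have := HI i 1%N Ii.
by rewrite big_ord1 addn0 -(real_normK (num_real (f i))) ler_pXn2r// nnegrE ltW.
Qed.

Lemma shift_poly_cvg0 (R : realType) (p : {poly R}) (s : nat -> R) :
  s @ \oo --> 0 -> shift_poly p s @ \oo --> 0.
Proof.
move=> s0.
have := @cvg_sum_ord R (size p) (fun j e => p`_j * s (e + j)%N) (fun=> 0).
rewrite big1//; apply => i _; rewrite -[X in _ --> X](mulr0 p`_i).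
by apply: cvgM; [exact: cvg_cst|exact: cvgn_addl].
Qed.

(** Induction on the degree. A root of [p] at 1 can be divided out: the quotient applied to [s] is
    constant and tends to 0. If [p.[1] != 0], the partial sums [G] make p(S)G a constant [K], while
    [G (m + j) - G m] tends to 0, so [G] tends to [K / p.[1]]. *)
Lemma recurrent_series_cvg (R : realType) (p : {poly R}) (s : nat -> R) :
  p != 0 -> s @ \oo --> 0 -> (forall e, shift_poly p s e = 0) ->
  cvg ((fun n => \sum_(i < n) s i) @ \oo).
Proof.
move=> p0 s0 ps; elim: {p}(size p) {-2}p (leqnn (size p)) p0 ps => [|n IH] p.
  by rewrite leqn0 size_poly_eq0 => /eqP -> /eqP.
move=> pn p0 ps; pose G n := \sum_(i < n) s i; rewrite -/G.
have [/factor_theorem [q pq]|p1] := boolP (root p 1).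
  rewrite polyC1 in pq.
  have q0 : q != 0 by apply: contraNneq p0 => q0; rewrite pq q0 mul0r.
  apply: (IH q) => //.
    rewrite -ltnS (leq_trans _ pn)// pq size_Mmonic ?monicXsubC//.
      by rewrite -polyC1 size_XsubC; lia.
  have qc e : shift_poly q s e = shift_poly q s 0.
    elim: e => // e IHe; rewrite -IHe; apply/eqP; rewrite -subr_eq0.
    by rewrite -shift_poly_mulX1 -pq ps.
  have /cvg_lim L := shift_poly_cvg0 q s0.
  move=> e; rewrite qc -[RHS]L//; apply/esym/cvg_lim => //.
  by rewrite (_ : shift_poly q s = cst (shift_poly q s 0)); [exact: cvg_cst|exact/funext].
pose K := shift_poly p G 0.
have GS m : G m.+1 = G m + s m by rewrite /G big_ord_recr.
have pG m : shift_poly p G m = K.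
  elim: m => // m <-; rewrite -[RHS]addr0 -(ps m) /shift_poly -big_split /=.
  by apply: eq_bigr => i _; rewrite addSn GS mulrDr.
have Gd j : (fun m => G (m + j)%N - G m) @ \oo --> 0.
  elim: j => [|j IHj].
    rewrite (_ : (fun _ => _) = cst 0); first exact: cvg_cst.
    by apply/funext => m; rewrite addn0 subrr.
  rewrite (_ : (fun _ => _) = (fun m => (G (m + j)%N - G m) + s (m + j)%N)); last first.
    by apply/funext => m; rewrite addnS GS; ring.
  by rewrite -[0 in X in _ --> X]addr0; apply: cvgD => //; exact: cvgn_addl.
have -> : G = fun m => (K - \sum_(j < size p) p`_j * (G (m + j)%N - G m)) / p.[1].
  apply/funext => m; apply: (canRL (mulfK p1)); rewrite -(pG m).
  rewrite /shift_poly horner_coef mulr_sumr -sumrB; apply: eq_bigr => i _.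
  by rewrite expr1n; ring.
apply: cvgP; apply: cvgM; last exact: cvg_cst.
apply: cvgB; first exact: cvg_cst.
apply: (@cvg_sum_ord R _ (fun j m => p`_j * (G (m + j)%N - G m)) (fun j => p`_j * 0)) => i _.
by apply: cvgM; [exact: cvg_cst|exact: Gd].
Qed.

Lemma prod_head_le (R : realType) (Q : R) I m : 1 <= Q ->
  \prod_(i < m) (if (i < I)%N then Q else 1) <= Q ^+ I.
Proof.
move=> Q1; suff -> : \prod_(i < m) (if (i < I)%N then Q else 1) = Q ^+ minn m I.
  by rewrite ler_weXn2l// geq_minr.
elim: m => [|m IH]; first by rewrite big_ord0 min0n expr0.
rewrite big_ord_recr /= IH; case: ltnP => mI.
  by rewrite (minn_idPl mI) exprSr.
by rewrite (minn_idPr (leqW mI)) mulr1.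
Qed.

(* Rows of index [i.+1] are replaced by [row i.+1 - a * row i]. *)
Lemma det_hankel_reduced (R : realType) (a : R) (s : nat -> R) (m : nat) :
  (\det (hankel s m.+1)) ^+ 2 <= (\sum_(j < m.+1) s j ^+ 2) *
    \prod_(i < m) \sum_(j < m.+1) (s (i + j).+1 - a * s (i + j)%N) ^+ 2.
Proof.
pose L : 'M[R]_m.+1 := \matrix_(i, j) ((i == j)%:R - a * ((i : nat) == j.+1)%:R).
have detL : \det L = 1.
  rewrite det_trig.
    by rewrite big1// => i _; rewrite mxE eqxx eqn_leq ltnn andbF mulr0 subr0.
  apply/is_trig_mxP => i j ij; rewrite mxE -val_eqE /=.
  by rewrite (ltn_eqF ij) (ltn_eqF (leqW ij)) mulr0 subr0.
have -> : \det (hankel s m.+1) = \det (L *m hankel s m.+1).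
  by rewrite det_mulmx detL mul1r.
apply: le_trans (hadamard _) _; rewrite big_ord_recl.
have LE (i j : 'I_m.+1) : (L *m hankel s m.+1) i j =
    s (i + j)%N - a * (if (i : nat) is i'.+1 then s (i' + j)%N else 0).
  rewrite mxE; under eq_bigr do rewrite !mxE mulrBl.
  rewrite sumrB (bigD1 i)//= eqxx mul1r big1 ?addr0; last first.
    by move=> k /negbTE ki; rewrite eq_sym ki mul0r.
  congr (_ - _); case: i => [[|i] im] /=.
    by rewrite mulr0 big1// => k _; rewrite mul0r.
  rewrite (bigD1 (Ordinal (ltnW im)))//= eqxx mulr1 big1 ?addr0//.
  move=> k ki; rewrite eqSS eq_sym.
  by move: ki; rewrite -val_eqE /= => /negbTE ->; rewrite mulr0 mul0r.
rewrite le_eqVlt; apply/orP; left; apply/eqP; congr (_ * _).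
  by apply: eq_bigr => j _; rewrite LE /= mulr0 subr0.
by apply: eq_bigr => i _; apply: eq_bigr => j _; rewrite LE.
Qed.

Lemma det_hankel_int (R : realType) (N : nat -> int) m :
  exists z : int, \det (hankel (fun i => (N i)%:~R : R) m) = z%:~R.
Proof.
exists (\det (\matrix_(i < m, j < m) N (i + j)%N)).
rewrite -[RHS]det_map_mx; congr (\det _); apply/matrixP => i j.
by rewrite !mxE.
Qed.

(* By Hadamard's inequality the reduced determinant is at most the product of a
   first row of size about a^m and of rows whose norms are tails of a convergent
   series, so this integer is eventually less than 1. *)
Lemma hankel_det_eventually0 (R : realType) (a c S : R) (N : nat -> int) :
  1 < a ->
  (forall n, \sum_(i < n) (c * a ^+ i - (N i)%:~R) ^+ 2 <= S) ->
  exists M, forall n, (M < n)%N -> \det (hankel (fun i => (N i)%:~R : R) n) = 0.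
Proof.
move=> a1 NS.
pose e i := c * a ^+ i - (N i)%:~R; pose s i : R := (N i)%:~R.
pose t i := (s i.+1 - a * s i) ^+ 2.
have a0 : 0 < a by lra.
(* The geometric part cancels in [s i.+1 - a * s i], which equals [a * e i - e i.+1], so the reduced
   entries are square-summable too. *)
have tE i : t i <= 2 * a ^+ 2 * e i ^+ 2 + 2 * e i.+1 ^+ 2.
  have -> : t i = (a * e i - e i.+1) ^+ 2 by rewrite /t /e /s [a ^+ i.+1]exprS; ring.
  have := sqr_ge0 (a * e i + e i.+1); nra.
have S0 : 0 <= S by have := NS 0%N; rewrite big_ord0.
pose T := 2 * a ^+ 2 * S + 2 * S.
have T0 : 0 <= T by have := exprn_gt0 2 a0; rewrite /T; nra.
have tT n : \sum_(i < n) t i <= T.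
  apply: (@le_trans _ _ (\sum_(i < n) (2 * a ^+ 2 * e i ^+ 2 + 2 * e i.+1 ^+ 2))).
    by apply: ler_sum => i _; exact: tE.
  rewrite big_split /= -!mulr_sumr /T; apply: lerD; apply: ler_wpM2l => //.
  - by have := exprn_gt0 2 a0; lra.
  - exact: NS.
  - apply: le_trans (NS n.+1); rewrite big_ord_recl /= ler_wpDl ?sqr_ge0//.
(* With this [b], the growth [(a ^+ 2) ^+ m] of the first row times [b ^+ m] is 4^-m; the factor
   [m.+1 <= 2 ^ m] then leaves 2^-m. *)
pose b : R := (4 * a ^+ 2)^-1.
have b0 : 0 < b by rewrite invr_gt0 mulr_gt0// exprn_gt0.
have [I HI] := bounded_sum_tail (fun i => sqr_ge0 (s i.+1 - a * s i)) tT b0.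
(* Only the first [I] rows can exceed [b]; each is at most [T <= b * Q], which costs the factor
   [Q ^+ I], independent of [m]. *)
pose Q := Num.max 1 (T / b).
have Q1 : 1 <= Q by rewrite le_max lexx.
have TQ : T <= b * Q by rewrite mulrC -ler_pdivrMr// le_max lexx orbT.
pose C := 2 * c ^+ 2 + 2 * S.
have C0 : 0 <= C by have := sqr_ge0 c; rewrite /C; lra.
have sC m j : (j <= m)%N -> s j ^+ 2 <= C * (a ^+ 2) ^+ m.
  move=> jm.
  have ej : e j ^+ 2 <= S.
    by apply: le_trans (NS j.+1); rewrite big_ord_recr /= lerDr sumr_ge0// => i _; exact: sqr_ge0.
  have aj : (a ^+ 2) ^+ j <= (a ^+ 2) ^+ m by apply: ler_weXn2l => //; rewrite exprn_ege1// ltW.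
  have a2 : 1 <= (a ^+ 2) ^+ j by rewrite exprn_ege1// exprn_ege1// ltW.
  have -> : s j = c * a ^+ j - e j by rewrite /e; ring.
  have : (c * a ^+ j - e j) ^+ 2 <= 2 * c ^+ 2 * (a ^+ 2) ^+ j + 2 * e j ^+ 2.
    by rewrite exprAC; have := sqr_ge0 (c * a ^+ j + e j); nra.
  have := sqr_ge0 c; rewrite /C; nra.
have detS m : (\det (hankel s m.+1)) ^+ 2 <= C * Q ^+ I / 2 ^+ m.
  apply: le_trans (det_hankel_reduced a s m) _.
  apply: (@le_trans _ _ ((m.+1%:R * (C * (a ^+ 2) ^+ m)) * (b ^+ m * Q ^+ I))).
    apply: ler_pM.
    - by apply: sumr_ge0 => i _; exact: sqr_ge0.
    - by apply: prodr_ge0 => i _; apply: sumr_ge0 => j _; exact: sqr_ge0.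
    - rewrite mulr_natl -[X in _ *+ X]card_ord -sumr_const.
      by apply: ler_sum => i _; apply: sC; rewrite -ltnS.
    - apply: (@le_trans _ _ (\prod_(i < m) (b * (if (i < I)%N then Q else 1)))).
        apply: ler_prod => i _; apply/andP; split.
          by apply: sumr_ge0 => j _; exact: sqr_ge0.
        case: ltnP => iI; last by rewrite mulr1; exact: HI.
        apply: le_trans TQ; apply: le_trans (tT (i + m.+1)%N).
        by rewrite big_split_ord /= lerDr sumr_ge0// => j _; exact: sqr_ge0.
      rewrite big_split /= prodr_const card_ord ler_wpM2l ?prod_head_le//.
      by rewrite exprn_ge0// ltW.
  have -> : m.+1%:R * (C * (a ^+ 2) ^+ m) * (b ^+ m * Q ^+ I) =
     C * Q ^+ I * (m.+1%:R * (a ^+ 2 * b) ^+ m).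
    have -> : (a ^+ 2 * b) ^+ m = (a ^+ 2) ^+ m * b ^+ m by rewrite exprMn.
    move: ((a ^+ 2) ^+ m) (b ^+ m) (Q ^+ I) (m.+1%:R : R) => x y z w.
    by ring.
  apply: ler_wpM2l; first by rewrite mulr_ge0// exprn_ge0//; lra.
  have -> : a ^+ 2 * b = (2 * 2)^-1 by rewrite /b; field; rewrite gt_eqF.
  rewrite exprVn exprMn -exprVn invfM exprVn mulrA ler_piMl ?invr_ge0 ?exprn_ge0//.
  by rewrite ler_pdivrMr ?exprn_gt0// mul1r -natrX ler_nat ltn_expl.
have [M HM] := expr_gt_near (C * Q ^+ I) (ltr1n R 2).
exists M => -[//|m] Mm.
have [z zE] := det_hankel_int R N m.+1.
have : (\det (hankel s m.+1)) ^+ 2 < 1.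
  apply: le_lt_trans (detS m) _; rewrite ltr_pdivrMr ?exprn_gt0// mul1r.
  exact: HM.
rewrite -[hankel s _]/(hankel (fun i => (N i)%:~R) _) zE => z1.
suff -> : z = 0 by [].
apply/eqP; rewrite -absz_eq0 -leqn0 -ltnS.
move: z1; rewrite -rmorphXn /= -[1]/(1%:~R) ltr_int => z1.
nia.
Qed.

(** If p(S) annihilates the integers [N i], then p(S) sends the errors to [p.[a] * (c * a ^+ n)].
    The errors tend to 0 and [a > 1], so [p.[a] = 0] and the errors satisfy the same recurrence. *)
Lemma pisot_series_cvg (R : realType) (a c S : R) (N : nat -> int) :
  1 < a -> c != 0 ->
  (forall n, \sum_(i < n) (c * a ^+ i - (N i)%:~R) ^+ 2 <= S) ->
  cvg ((fun n => \sum_(i < n) (c * a ^+ i - (N i)%:~R)) @ \oo).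
Proof.
move=> a1 c0 NS; pose e i := c * a ^+ i - (N i)%:~R.
have [M /kronecker [p p0 pN]] := hankel_det_eventually0 a1 NS.
have e0 : e @ \oo --> 0 := bounded_sum_cvg0 NS.
have pe n : shift_poly p e n = p.[a] * (c * a ^+ n).
  by rewrite /e shift_polyB shift_poly_geom pN subr0.
apply: (@recurrent_series_cvg R p e p0 e0) => n; rewrite pe.
suff /eqP -> : p.[a] == 0 by rewrite mul0r.
apply/negPn/negP => pa0.
have pc : 0 < `|p.[a] * c| by rewrite normr_gt0 mulf_neq0.
have /cvgr0Pnorm_lt/(_ _ pc)[K _ HK] := shift_poly_cvg0 p e0.
have := HK K (leqnn K); rewrite pe mulrA normrM.
rewrite ltNge ler_peMr ?normr_ge0// normrX exprn_ege1// ger0_norm ltW//.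
exact: lt_trans a1.
Qed.

(** * Sums of random bits *)

(* The mean of [f (\sum_(i < n) b_i * u i)] over independent fair bits [b_i]. *)
Fixpoint Ex (R : realType) (u : nat -> R) (n : nat) (f : R -> R) : R :=
  if n is n'.+1 then Ex u n' (fun z => (f z + f (z + u n')) / 2) else f 0.

Section ExTheory.
Variables (R : realType) (u : nat -> R).

Lemma eq_Ex n f g : f =1 g -> Ex u n f = Ex u n g.
Proof. by move=> /funext ->. Qed.

Lemma Ex_cst n (c : R) : Ex u n (fun=> c) = c.
Proof. by elim: n => //= n IH; rewrite (_ : (c + c) / 2 = c); [|field]. Qed.

Lemma ExD n f g : Ex u n (fun z => f z + g z) = Ex u n f + Ex u n g.
Proof.
elim: n f g => //= n IH f g; rewrite -IH; apply: eq_Ex => z.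
by field.
Qed.

Lemma ExZ n k f : Ex u n (fun z => k * f z) = k * Ex u n f.
Proof.
elim: n f => //= n IH f; rewrite -IH; apply: eq_Ex => z.
by field.
Qed.

Lemma ExB n f g : Ex u n (fun z => f z - g z) = Ex u n f - Ex u n g.
Proof.
elim: n f g => //= n IH f g; rewrite -IH; apply: eq_Ex => z.
by field.
Qed.

Lemma le_Ex n f g : (forall z, f z <= g z) -> Ex u n f <= Ex u n g.
Proof.
elim: n f g => //= n IH f g fg; apply: IH => z.
by rewrite ler_pM2r ?invr_gt0// lerD.
Qed.

(** Averaging over one bit moves the phase by [w / 2 * u n] and multiplies by the cosine of that
    same angle. *)
Lemma Ex_cos n (w p : R) : Ex u n (fun z => cos (w * z + p)) =
  cos (p + w / 2 * \sum_(i < n) u i) * \prod_(i < n) cos (w / 2 * u i).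
Proof.
elim: n p => [|n IH] p /=.
  by rewrite !big_ord0 mulr1 !mulr0 add0r addr0.
rewrite (_ : (fun _ => _) =
    (fun z => cos (w / 2 * u n) * cos (w * z + (p + w / 2 * u n)))); last first.
  apply/funext => z; rewrite (_ : w * (z + u n) + p =
    (w * z + (p + w / 2 * u n)) + w / 2 * u n); last by field.
  rewrite {1}(_ : w * z + p =
    (w * z + (p + w / 2 * u n)) - w / 2 * u n); last by ring.
  set A := w * z + _; set B := w / 2 * _; rewrite (cosB A B) (cosD A B); by field.
rewrite (ExZ n (cos (w / 2 * u n)) (fun z => cos (w * z + (p + w / 2 * u n)))).
rewrite IH !big_ord_recr /=; set S := \sum_(i < n) _.
by rewrite (_ : p + w / 2 * (S + u n) = p + w / 2 * u n + w / 2 * S); ring.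
Qed.

End ExTheory.

(** * Convergence of the Fourier coefficients *)

Lemma cosD2piz (R : realType) (x : R) (N : int) :
  cos (x + 2 * pi * N%:~R) = cos x.
Proof.
have H (y : R) n : cos (y + 2 * pi * n%:R) = cos y.
  rewrite -[RHS](periodicn (@cosD2pi R) n); congr cos.
  by rewrite -[pi *+ 2 *+ n]mulr_natr -[pi *+ 2]mulr_natl.
case: N => n; first exact: H.
rewrite NegzE mulrNz -[LHS](H _ n.+1); congr cos.
by ring.
Qed.

(** Both factors change by the same sign. This allows [d * a ^+ i] to be replaced by its signed
    distance to the nearest integer in the phase and in the product at once. *)
Lemma cosM_piz (R : realType) (x y : R) (N : int) :
  cos (x + pi * N%:~R) * cos (y + pi * N%:~R) = cos x * cos y.
Proof.
have H (s t : R) : cos s * cos t = (cos (s + t) + cos (s - t)) / 2.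
  by rewrite cosD cosB; field.
rewrite !H; congr ((_ + cos _) / 2); last by ring.
by rewrite -[RHS](cosD2piz _ N); congr cos; ring.
Qed.

(** The mean value theorem gives sin (x / 2) >= cos (pi / 4) * x / 2 for x in [0, pi / 2], and cos x
    = 1 - 2 sin (x / 2)^2. *)
Lemma cos_le_quadratic (R : realType) :
  exists2 k : R, 0 < k & forall x, `|x| <= pi / 2 -> cos x <= 1 - k * x ^+ 2.
Proof.
have p0 : 0 < pi :> R := pi_gt0 R.
pose q : R := cos (pi / 4).
have q0 : 0 < q by apply: cos_gt0_pihalf; lra.
exists (q ^+ 2 / 2) => [|x xp]; first by rewrite divr_gt0// exprn_gt0.
rewrite -cos_norm -(real_normK (num_real x)).
move: (`|x|) (normr_ge0 x) xp => {}x x0 xp.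
have sx : q * (x / 2) <= sin (x / 2).
  have x20 : 0 <= x / 2 by rewrite divr_ge0.
  have [z zx] := @MVT_segment R sin cos 0 (x / 2) x20
    (fun y _ => is_derive_sin y) (continuous_subspaceT (@continuous_sin R)).
  rewrite sin0 !subr0 => ->; rewrite ler_wpM2r//.
  move: zx; rewrite in_itv /= => /andP[z0 zx].
  rewrite leNgt; apply/negP; rewrite ltr_cos ?in_itv /=; try (apply/andP; split); lra.
have -> : cos x = 1 - 2 * sin (x / 2) ^+ 2.
  rewrite {1}(_ : x = (x / 2) *+ 2); last by rewrite -mulr_natr; field.
  by rewrite cos_mulr2n cos2sin2; ring.
have : 0 <= q * (x / 2) by rewrite mulr_ge0 ?divr_ge0// ltW.
nra.
Qed.

(** Serves to bound the sum of the [t i] once the product is bounded below; each step is (1 - x)(1 +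
    S + x) <= 1 + S. *)
Lemma prod_le_invsum (R : realType) (t : nat -> R) n :
  (forall i, 0 <= t i <= 1) ->
  (\prod_(i < n) (1 - t i)) * (1 + \sum_(i < n) t i) <= 1.
Proof.
move=> t01.
have P0 m : 0 <= \prod_(i < m) (1 - t i).
  by apply: prodr_ge0 => i _; have /andP[] := t01 i; lra.
have S0 m : 0 <= \sum_(i < m) t i.
  by apply: sumr_ge0 => i _; have /andP[] := t01 i.
elim: n => [|n IH]; first by rewrite !big_ord0 addr0 mulr1.
rewrite !big_ord_recr /=; apply: le_trans IH.
rewrite -mulrA ler_wpM2l ?P0//.
have /andP[t0 _] := t01 n; have := mulr_ge0 t0 (S0 n).
move: (\sum_(i < n) t i) (t n) => S x; have := sqr_ge0 x. nra.
Qed.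

Lemma Ex_cos_cvg (R : realType) (a c p : R) (h : int) : 1 < a -> c != 0 ->
  cvg ((fun n => Ex (fun i => c * a ^+ i) n
    (fun z => cos (2 * pi * h%:~R * z + p))) @ \oo).
Proof.
move=> a1 c0.
have [->|h0] := eqVneq h 0.
  rewrite (_ : (fun _ => _) = cst (cos p)); first exact: is_cvg_cst.
  apply/funext => n; rewrite -[RHS](Ex_cst (fun i => c * a ^+ i) n).
  by apply: eq_Ex => z; rewrite mulr0 mul0r add0r.
pose d := h%:~R * c; have d0 : d != 0 by rewrite mulf_neq0// intr_eq0.
(* The nearest integer, so that [e i] lies in [-1/2, 1/2] and every factor [cos (pi * e i)] is
   nonnegative. *)
pose N i := Num.floor (d * a ^+ i + 1 / 2).
pose e i := d * a ^+ i - (N i)%:~R.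
have e2 i : `|e i| <= 1 / 2.
  have := floor_itv (d * a ^+ i + 1 / 2); rewrite -/(N i) /e intrD => /andP[H1 H2].
  by rewrite ler_norml; apply/andP; split; lra.
have p0 : 0 < pi :> R := pi_gt0 R.
have cose i : 0 <= cos (pi * e i).
  by apply: cos_ge0_pihalf; have := e2 i; rewrite ler_norml; nra.
have ExE n : Ex (fun i => c * a ^+ i) n (fun z => cos (2 * pi * h%:~R * z + p)) =
   cos (p + pi * \sum_(i < n) e i) * \prod_(i < n) cos (pi * e i).
  rewrite Ex_cos.
  transitivity (cos (p + pi * \sum_(i < n) (d * a ^+ i)) *
                \prod_(i < n) cos (pi * (d * a ^+ i))).
    congr (cos (_ + _) * _).
      by rewrite !mulr_sumr; apply: eq_bigr => i _; rewrite /d; field.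
    by apply: eq_bigr => i _; congr cos; rewrite /d; field.
  elim: n p => [|n IH] q; first by rewrite !big_ord0 mulr1.
  rewrite !big_ord_recr /= mulrDr [in LHS](addrC (pi * _)) addrA [LHS]mulrA IH.
  rewrite -[LHS]mulrA mulrCA [RHS]mulrCA; congr (_ * _).
  rewrite -(cosM_piz (q + _) _ (N n)); congr (cos _ * cos _); rewrite /e; ring.
have cvP : cvg ((fun n => \prod_(i < n) cos (pi * e i)) @ \oo).
  apply: nonincreasing_is_cvgn; last first.
    by exists 0 => _ [n _ <-]; exact: prodr_ge0.
  apply/nonincreasing_seqP => n; rewrite big_ord_recr /= ler_piMr ?cos_le1//.
  exact: prodr_ge0.
rewrite (_ : (fun _ => _) = (fun n => cos (p + pi * \sum_(i < n) e i) *
   \prod_(i < n) cos (pi * e i))); last exact/funext.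
pose l := lim ((fun n => \prod_(i < n) cos (pi * e i)) @ \oo).
have l0 : 0 <= l by apply: limr_ge => //; apply: nearW => n; exact: prodr_ge0.
have [lE|ln0] := eqVneq l 0.
  apply/cvg_ex; exists 0; apply/cvgr0Pnorm_le => x x0.
  have : (fun n => \prod_(i < n) cos (pi * e i)) @ \oo --> 0 by rewrite -lE.
  move=> /cvgr0Pnorm_le/(_ _ x0); apply: filterS => n; apply: le_trans.
  by rewrite normrM ler_piMl// cos_max.
(* A positive limit bounds the sum of [1 - cos (pi * e i)] by [l^-1], hence the sum of the
   [e i ^+ 2], and the phase then converges by [pisot_series_cvg]. *)
have {ln0 l0}l0 : 0 < l by rewrite lt_def ln0.
have [k k0 Hk] := cos_le_quadratic R.
pose t i := 1 - cos (pi * e i).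
have t01 i : 0 <= t i <= 1.
  by rewrite /t; have := cose i; have := cos_le1 (pi * e i); lra.
have tk i : k * pi ^+ 2 * e i ^+ 2 <= t i.
  have : `|pi * e i| <= pi / 2.
    by rewrite normrM gtr0_norm//; have := e2 i; nra.
  by move=> /Hk; rewrite /t exprMn; lra.
have S n : \sum_(i < n) t i <= l^-1.
  rewrite -[leRHS]mul1r ler_pdivlMr//.
  have S0 : 0 <= \sum_(i < n) t i.
    by apply: sumr_ge0 => i _; have /andP[] := t01 i.
  have lP : l <= \prod_(i < n) cos (pi * e i).
    apply: nonincreasing_cvgn_ge => //.
    apply/nonincreasing_seqP => m; rewrite big_ord_recr /= ler_piMr ?cos_le1//.
    exact: prodr_ge0.
  have := prod_le_invsum n t01.
  have -> : \prod_(i < n) (1 - t i) = \prod_(i < n) cos (pi * e i).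
    by apply: eq_bigr => i _; rewrite /t; ring.
  nra.
apply: is_cvgM => //.
have kp : 0 < k * pi ^+ 2 by rewrite mulr_gt0// exprn_gt0.
have eS n : \sum_(i < n) e i ^+ 2 <= (k * pi ^+ 2)^-1 * l^-1.
  rewrite -ler_pdivrMl ?invr_gt0// invrK; apply: le_trans (S n).
  by rewrite mulr_sumr; apply: ler_sum => i _; exact: tk.
have /cvg_ex[s Hs] := pisot_series_cvg a1 d0 eS.
apply/cvg_ex; exists (cos (p + pi * s)).
apply: continuous_cvg; first exact: continuous_cos.
apply: cvgD; first exact: cvg_cst.
by apply: cvgM; [exact: cvg_cst|exact: Hs].
Qed.

(** * Approximation of step functions *)

Section TrigonometricPolynomials.
Variable R : realType.

(** Real trigonometric polynomials of period 1; the arbitrary phase [p] makes sines available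
    without a second constructor. *)
Inductive trig : (R -> R) -> Prop :=
| trig_cos c (h : int) p : trig (fun z => c * cos (2 * pi * h%:~R * z + p))
| trig_add f g : trig f -> trig g -> trig (fun z => f z + g z).

Lemma trig_cst c : trig (fun=> c).
Proof.
rewrite (_ : (fun=> c) = (fun z => c * cos (2 * pi * 0%:~R * z + 0))).
  exact: trig_cos.
by apply/funext => z; rewrite mulr0 mul0r add0r cos0 mulr1.
Qed.

Lemma trigM f g : trig f -> trig g -> trig (fun z => f z * g z).
Proof.
elim=> [c h p|f1 f2 _ IH1 _ IH2]; last first.
  move=> tg; rewrite (_ : (fun _ => _) = (fun z => f1 z * g z + f2 z * g z)).
    by apply: trig_add; [exact: IH1|exact: IH2].
  by apply/funext => z; rewrite mulrDl.
elim=> [c' h' p'|g1 g2 _ IH1 _ IH2]; last first.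
  pose f0 z := c * cos (2 * pi * h%:~R * z + p).
  rewrite (_ : (fun _ => _) = (fun z => f0 z * g1 z + f0 z * g2 z)).
    by apply: trig_add; [exact: IH1|exact: IH2].
  by apply/funext => z; rewrite mulrDr.
rewrite (_ : (fun _ => _) = (fun z =>
    c * c' / 2 * cos (2 * pi * (h + h')%:~R * z + (p + p')) +
    c * c' / 2 * cos (2 * pi * (h - h')%:~R * z + (p - p')))).
  by apply: trig_add; exact: trig_cos.
apply/funext => z.
have -> : 2 * pi * (h + h')%:~R * z + (p + p') =
  (2 * pi * h%:~R * z + p) + (2 * pi * h'%:~R * z + p') by rewrite intrD; ring.
have -> : 2 * pi * (h - h')%:~R * z + (p - p') =
  (2 * pi * h%:~R * z + p) - (2 * pi * h'%:~R * z + p') by rewrite intrB; ring.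
by move: (_ + p) (_ + p') => A B; rewrite cosB cosD; field.
Qed.

Lemma trigX f n : trig f -> trig (fun z => f z ^+ n).
Proof.
move=> tf; elim: n => [|n IH]; first exact: (trig_cst 1).
rewrite (_ : (fun _ => _) = (fun z => f z * f z ^+ n)); first exact: trigM.
by apply/funext => z; rewrite exprS.
Qed.

Lemma trig_cvg (a c : R) f : 1 < a -> c != 0 -> trig f ->
  cvg ((fun n => Ex (fun i => c * a ^+ i) n f) @ \oo).
Proof.
move=> a1 c0; elim=> [k h p|f1 f2 _ c1 _ c2].
  rewrite (_ : (fun _ => _) = (fun n => k * Ex (fun i => c * a ^+ i) n
      (fun z => cos (2 * pi * h%:~R * z + p)))).
    by apply: is_cvgM; [exact: is_cvg_cst|exact: Ex_cos_cvg].
  by apply/funext => n; rewrite -ExZ.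
rewrite (_ : (fun _ => _) = (fun n => Ex (fun i => c * a ^+ i) n f1 +
   Ex (fun i => c * a ^+ i) n f2)); first exact: is_cvgD.
by apply/funext => n; rewrite -ExD.
Qed.

End TrigonometricPolynomials.

Lemma bernoulli_ge (R : realDomainType) (x : R) n : 0 <= x <= 1 ->
  1 - n%:R * x <= (1 - x) ^+ n.
Proof.
move=> x01; elim: n => [|n IH]; first by rewrite mul0r subr0 expr0.
have n0 : 0 <= n%:R :> R by [].
by rewrite exprS -natr1; nra.
Qed.

Lemma bernoulli_le (R : realDomainType) (x : R) n : 0 <= x <= 1 ->
  (1 - x) ^+ n * (1 + n%:R * x) <= 1.
Proof.
move=> x01; elim: n => [|n IH]; first by rewrite mul0r addr0 expr0 mulr1.
have n0 : 0 <= n%:R :> R by [].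
have p0 : 0 <= (1 - x) ^+ n by rewrite exprn_ge0//; lra.
apply: le_trans IH; rewrite exprSr -mulrA ler_wpM2l//.
by rewrite -natr1; nra.
Qed.

(* The polynomials [(1 - s ^ m) ^ M] with [M] close to [t ^ (- m)] approximate
   the indicator of [s < t]. *)
Lemma step_approx (R : realType) (t d e : R) : 0 < t < 1 -> 0 < d -> 0 < e ->
  exists m M : nat, forall s, 0 <= s <= 1 ->
    [/\ 0 <= (1 - s ^+ m) ^+ M <= 1,
        s <= t - d -> 1 - e <= (1 - s ^+ m) ^+ M &
        t + d <= s -> (1 - s ^+ m) ^+ M <= e].
Proof.
move=> /andP[t0 t1] d0 e0.
(* For [s <= t - d], [s ^+ m] is at most [q ^+ m * t ^+ m]; the maximum with 0 keeps [q] nonnegative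
   when [d > t]. *)
pose q := Num.max (t - d) 0 / t.
have q0 : 0 <= q by rewrite divr_ge0 ?(ltW t0)// le_max lexx orbT.
have q1 : q < 1 by rewrite /q ltr_pdivrMr// mul1r gt_max t0 andbT; lra.
have nq : `|q| < 1 by rewrite ger0_norm.
have e20 : 0 < e / 2 by rewrite divr_gt0.
have /cvgr0Pnorm_lt/(_ _ e20)[m1 _ H1] := cvg_expr nq.
have td1 : 1 < (t + d) / t by rewrite ltr_pdivlMr// mul1r; lra.
have [m2 H2] := expr_gt_near e^-1 td1.
pose m := maxn m1 m2.
have {H1}H1 : q ^+ m <= e / 2.
  by have := H1 m (leq_maxl _ _); rewrite /= ger0_norm ?exprn_ge0// => /ltW.
have {H2}H2 : e^-1 <= ((t + d) / t) ^+ m by apply/ltW/H2/leq_maxr.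
(* Then [M%:R * t ^+ m] lies in [1, 2], so [M%:R * s ^+ m] is at most [e] left of the gap and at
   least [e^-1] right of it; the two Bernoulli bounds conclude. *)
pose M := (Num.truncn (t ^- m)).+1.
have tm0 : 0 < t ^+ m by rewrite exprn_gt0.
have tm1 : t ^+ m <= 1 by rewrite exprn_ile1// ltW.
have M1 : 1 <= M%:R * t ^+ m.
  by rewrite -ler_pdivrMr// mul1r ltW// truncnS_gt.
have M2 : M%:R * t ^+ m <= 2.
  have : (Num.truncn (t ^- m))%:R <= t ^- m by rewrite truncn_le invr_ge0 ltW.
  rewrite -ler_pdivlMr// /M -natr1 => H.
  have : 1 <= t ^- m by rewrite invf_ge1.
  lra.
exists m, M => s /andP[s0 s1].
have sm0 : 0 <= s ^+ m by rewrite exprn_ge0.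
have sm1 : s ^+ m <= 1 by rewrite exprn_ile1.
have sm01 : 0 <= s ^+ m <= 1 by rewrite sm0.
have p0 : 0 <= (1 - s ^+ m) ^+ M by rewrite exprn_ge0//; lra.
split.
- by rewrite p0 /= exprn_ile1//; lra.
- move=> sd; apply: le_trans (bernoulli_ge M sm01).
  have sq : s ^+ m <= q ^+ m * t ^+ m.
    have qt0 : 0 <= q * t := mulr_ge0 q0 (ltW t0).
    rewrite -exprMn; apply: lerXn2r; rewrite ?nnegrE//.
    by rewrite /q divfK ?gt_eqF// le_max sd.
  have M0 : 0 <= M%:R :> R by [].
  have : 0 <= q ^+ m by rewrite exprn_ge0.
  have : M%:R * s ^+ m <= M%:R * (q ^+ m * t ^+ m) by apply: ler_wpM2l.
  nra.
- move=> sd; have := bernoulli_le M sm01.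
  have sq : e^-1 <= M%:R * s ^+ m.
    have : (t + d) ^+ m <= s ^+ m by apply: lerXn2r; rewrite ?nnegrE//; lra.
    move: H2; rewrite expr_div_n ler_pdivlMr//.
    have e1 : 0 < e^-1 by rewrite invr_gt0.
    have M0 : 0 <= M%:R :> R by [].
    have : e^-1 <= e^-1 * (M%:R * t ^+ m) by rewrite ler_peMr// ltW.
    nra.
  have : 1 <= e * (M%:R * s ^+ m) by rewrite -ler_pdivrMl// mulr1.
  nra.
Qed.

(** * Concentration *)

Definition escapes (R : realType) (u : nat -> R) := forall (D : seq R) (k : nat),
  exists2 i, (k <= i)%N & all (fun d => u i - d \isn't a Num.int) D.

Lemma common_denominator (R : realType) (D : seq R) :
  exists2 Q : int, Q != 0 &
    forall d q, d \in D -> d = ratr q -> Q%:~R * d \is a Num.int.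
Proof.
elim: D => [|d D [Q Q0 IH]]; first by exists 1.
have [[q dq]|nq] := EM (exists q : rat, d = ratr q); last first.
  exists Q => // x q; rewrite inE => /orP[/eqP -> dq|xD]; last exact: IH xD.
  by exfalso; apply: nq; exists q.
exists (Q * denq q); first by rewrite mulf_neq0.
move=> x q'; rewrite inE => /orP[/eqP -> _|xD xq]; last first.
  by rewrite intrM mulrAC rpredM ?(IH _ _ xD xq)// intr_int.
rewrite intrM -mulrA rpredM ?intr_int// dq mulrC.
by rewrite /ratr divfK ?intr_int ?intr_eq0 ?denq_neq0.
Qed.

(** By coprimality every power of the denominator divides the nonzero integer [z = x]; a denominator
    of at least 2 fails at the exponent [|x|], as [|x| < 2 ^ |x|]. *)
Lemma ratr_geometric_int (R : realType) (q : rat) (z : R) : z != 0 ->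
  (forall t, z * ratr q ^+ t \is a Num.int) -> denq q = 1.
Proof.
move=> z0 zint.
have /intrP[x xE] : z \is a Num.int by have := zint 0%N; rewrite expr0 mulr1.
have x0 : x != 0 by move: z0; rewrite xE intr_eq0.
have dz t : (`|denq q| ^ t %| `|x|)%N.
  have /intrP[y yE] := zint t.
  have : y * denq q ^+ t = x * numq q ^+ t.
    apply: (@intr_inj R); rewrite !intrM !rmorphXn /= -yE xE.
    rewrite -mulrA -exprMn; congr (_ * _ ^+ _).
    by rewrite /ratr divfK// intr_eq0 denq_neq0.
  move/(congr1 absz); rewrite !abszM !abszX => H.
  rewrite -(@Gauss_dvdl _ _ (`|numq q| ^ t)) -?H ?dvdn_mull//.
  by rewrite coprimeXl// coprimeXr// coprime_sym coprime_num_den.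
have d0 : (0 < `|denq q|)%N by rewrite absz_gt0 denq_neq0.
suff : (`|denq q| < 2)%N by have := denq_gt0 q; lia.
rewrite ltnNge; apply/negP => d2.
have := dvdn_leq _ (dz `|x|%N); rewrite absz_gt0 x0 => /(_ isT).
by rewrite leqNgt (leq_trans (ltn_expl `|x|%N (ltnSn 1)))// leq_exp2r ?absz_gt0.
Qed.

(** Otherwise the tail has finitely many values mod 1. A repetition forces [a] and [c] to be
    rational, so one integer [Q] clears the denominators of the whole tail, and only an integer
    ratio allows this. *)
Lemma geometric_escapes (R : realType) (a c : R) : 1 < a -> c != 0 ->
  escapes (fun i => c * a ^+ i) \/ exists k : int, a = k%:~R.
Proof.
move=> a1 c0; pose u i := c * a ^+ i.
have [?|/existsNP[D /existsNP[k Hk]]] := EM (escapes u); [by left|right].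
have {}Hk i : (k <= i)%N -> has (fun d => u i - d \is a Num.int) D.
  move=> ki; apply/negPn/negP; rewrite -all_predC => nD; apply: Hk.
  by exists i.
pose f i := find (fun d => u (k + i)%N - d \is a Num.int) D.
have fD i : (f i < size D)%N by rewrite -has_find (Hk (k + i)%N)// leq_addr.
have fE i : u (k + i)%N - nth 0 D (f i) \is a Num.int.
  exact: (nth_find 0 (Hk (k + i)%N (leq_addr _ _))).
(* The pigeonhole is applied to pairs of consecutive classes: a repeated pair makes both a nonzero
   number and its product with [a] integers. *)
pose T := ('I_(size D) * 'I_(size D))%type.
pose g (i : 'I_#|{: T}|.+1) : T := (Ordinal (fD i), Ordinal (fD i.+1)).
have : ~~ injectiveb g.
  by apply/injectiveP => /leq_card; rewrite card_ord ltnn.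
move=> /injectivePn[i0 [j0 ij0 [gij gij1]]].
have [i [j [ij fij fij1]]] : exists i j : nat,
    [/\ (i < j)%N, f i = f j & f i.+1 = f j.+1].
  have := ij0; rewrite -val_eqE /= neq_ltn => /orP[ij|ij].
    by exists i0, j0.
  by exists j0, i0.
have fint l m : f l = f m -> u (k + m)%N - u (k + l)%N \is a Num.int.
  move=> lm; have -> : u (k + m)%N - u (k + l)%N =
    (u (k + m)%N - nth 0 D (f m)) - (u (k + l)%N - nth 0 D (f l)).
    by rewrite lm; ring.
  by rewrite rpredB.
have a0 : 0 < a by apply: lt_trans a1.
have an0 : a != 0 by rewrite gt_eqF.
pose t := (j - i)%N.
have at1 : a ^+ t - 1 != 0.
  by rewrite subr_eq0 gt_eqF// exprn_egt1// /t -lt0n subn_gt0.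
have uij l : u (k + j + l)%N - u (k + i + l)%N = u (k + i)%N * a ^+ l * (a ^+ t - 1).
  have -> : (k + j + l = (k + i) + l + t)%N by rewrite /t; lia.
  by rewrite /u !exprD; ring.
have ui0 l : u l != 0 by rewrite /u mulf_neq0// expf_neq0.
have /intrP[A AE] : u (k + i)%N * (a ^+ t - 1) \is a Num.int.
  by have := fint _ _ fij; have := uij 0%N; rewrite !addn0 mulr1 => ->.
have /intrP[B BE] : u (k + i)%N * (a ^+ t - 1) * a \is a Num.int.
  have := fint _ _ fij1; have := uij 1%N; rewrite !addnS !addn0 expr1 => ->.
  by rewrite mulrAC.
have A0 : A%:~R != 0 :> R by rewrite -AE mulf_neq0.
have [q aq] : exists q : rat, a = ratr q.
  exists (B%:~R / A%:~R); rewrite fmorph_div /= !ratr_int -BE -AE mulrC mulKf// AE.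
  exact: A0.
have uq l : exists p, u l = ratr p.
  have ci : c = A%:~R / ((a ^+ t - 1) * a ^+ (k + i)).
    by rewrite -AE /u; field; rewrite at1 expf_neq0.
  exists (A%:~R / ((q ^+ t - 1) * q ^+ (k + i)) * q ^+ l).
  by rewrite /u {1}ci aq rmorphM /= fmorph_div /= rmorphM /= rmorphB /= !rmorphXn /= rmorph1 ratr_int.
have [Q Q0 HQ] := common_denominator D.
exists (numq q); suff : denq q = 1.
  by move=> dq; rewrite {1}aq /ratr dq divr1.
apply: (@ratr_geometric_int R _ (Q%:~R * u k)) => [|l].
  by rewrite mulf_neq0// intr_eq0.
rewrite -mulrA -aq; have -> : u k * a ^+ l = u (k + l)%N by rewrite /u exprD mulrA.
set d := nth 0 D (f l); have dD : d \in D by rewrite mem_nth.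
have := fE l; rewrite -/d => ud; have /intrP[y yE] := ud.
have [p pE] := uq (k + l)%N.
have dr : d = ratr (p - y%:~R).
  by rewrite rmorphB /= ratr_int -pE -yE; ring.
have -> : Q%:~R * u (k + l)%N = Q%:~R * (u (k + l)%N - d) + Q%:~R * d by ring.
by rewrite rpredD ?(HQ _ _ dD dr)// rpredM ?intr_int.
Qed.

(* [P] lists the subset sums of [k] suitable terms of [u]; the bound follows by
   conditioning on the bits of the other terms. *)
Lemma escapes_spread (R : realType) (u : nat -> R) (k : nat) : escapes u ->
  exists (P : seq R) (n1 : nat),
    pairwise (fun p q => p - q \isn't a Num.int) P /\
    forall n f M, (n1 <= n)%N -> (forall v, \sum_(p <- P) f (v + p) <= M) ->
      Ex u n f <= M / 2 ^+ k.
Proof.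
move=> uesc; elim: k => [|k [P [n1 [Pd HP]]]].
  exists [:: 0], 0%N; split => // n f M _ fM.
  rewrite expr0 divr1 -(Ex_cst u n M); apply: le_Ex => z.
  by have := fM z; rewrite big_seq1 addr0.
(* Avoiding all differences [p - q] mod 1 makes the translate of [P] by [u i] disjoint from [P] mod
   1. *)
have [i n1i iP] := uesc [seq p - q | p <- P, q <- P] n1.
exists (P ++ [seq p + u i | p <- P]), i.+1; split.
  rewrite pairwise_cat Pd pairwise_map /= andbC; apply/andP; split.
    by apply: sub_pairwise Pd => p q /=; rewrite (_ : p + u i - (q + u i) = p - q)//; ring.
  apply/allrelP => p _ pP /mapP[q qP ->].
  have /= := allP iP _ (allpairs_f (fun x y => x - y) pP qP).
  by rewrite -rpredN (_ : - (u i - (p - q)) = p - (q + u i))//; ring.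
(* Bits after position [i] are averaged into [f], which preserves the bound [M]; at length [i.+1],
   averaging over bit [i] halves it. *)
move=> n f M; elim: n f => // n IHn f.
rewrite leq_eqVlt => /orP[/eqP[<-]|]; last first.
  rewrite ltnS => /IHn {}IHn fM /=; apply: IHn => v.
  rewrite -mulr_suml big_split /= ler_pdivrMr//.
  have fM2 : \sum_(p <- P ++ [seq p + u i | p <- P]) f (v + p + u n) <= M.
    by under eq_bigr do rewrite addrAC; exact: fM.
  by have := fM v; lra.
move=> fM /=; have := HP i (fun z => (f z + f (z + u i)) / 2) (M / 2) n1i.
rewrite exprS invfM mulrA; apply => v.
rewrite -mulr_suml ler_wpM2r ?invr_ge0//.
have := fM v; rewrite big_cat big_map big_split /=.
have -> : \sum_(p <- P) f (v + (p + u i)) = \sum_(p <- P) f (v + p + u i).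
  by under eq_bigr do rewrite addrA.
by [].
Qed.

Lemma sinpi_neq0 (R : realType) (x : R) : x \isn't a Num.int -> sin (pi * x) != 0.
Proof.
move=> xint; apply/eqP => sx.
have p0 : 0 < pi :> R := pi_gt0 R.
pose N := Num.floor x; pose y := x - N%:~R.
have /andP[Nx xN] := floor_itv x; rewrite -/N intrD in Nx xN.
have y0 : 0 < y.
  rewrite subr_gt0 lt_neqAle Nx andbT; apply: contraNneq xint => <-.
  exact: intr_int.
have y1 : y < 1 by rewrite /y; lra.
have c2 (z : R) : cos (2 * pi * z) = 1 - 2 * sin (pi * z) ^+ 2.
  rewrite (_ : 2 * pi * z = (pi * z) *+ 2); last by ring.
  by rewrite cos_mulr2n cos2sin2; ring.
have : cos (2 * pi * y) = cos (2 * pi * x).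
  by rewrite -(cosD2piz _ N); congr cos; rewrite /y; ring.
rewrite !c2 sx; have : 0 < sin (pi * y) by apply: sin_gt0_pi; nra.
nra.
Qed.

(* cos (2 pi t) takes a value close to [k] at no three well separated points
   of the circle: sum-to-product turns two such pairs into two small sines
   whose arguments differ by a separated angle. *)
Lemma cos_three_points (R : realType) (g d k p q r : R) : 0 < g ->
  g <= `|sin (pi * (p - q))| -> g <= `|sin (pi * (p - r))| ->
  g <= `|sin (pi * (q - r))| ->
  `|cos (2 * pi * p) - k| <= d -> `|cos (2 * pi * q) - k| <= d ->
  `|cos (2 * pi * r) - k| <= d -> g ^+ 2 <= 2 * d.
Proof.
move=> g0 gpq gpr gqr dp dq dr.
have H (x y : R) : `|cos (2 * pi * x) - k| <= d -> `|cos (2 * pi * y) - k| <= d ->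
    g <= `|sin (pi * (x - y))| -> g * `|sin (pi * (x + y))| <= d.
  move=> dx dy gxy.
  have E : cos (2 * pi * x) - cos (2 * pi * y) =
      - 2 * (sin (pi * (x - y)) * sin (pi * (x + y))).
    rewrite (_ : 2 * pi * x = pi * (x + y) + pi * (x - y)); last by ring.
    rewrite (_ : 2 * pi * y = pi * (x + y) - pi * (x - y)); last by ring.
    by rewrite cosD cosB; ring.
  have : `|cos (2 * pi * x) - cos (2 * pi * y)| <= 2 * d.
    by move: dx dy; rewrite !ler_norml => /andP[? ?] /andP[? ?]; apply/andP; split; lra.
  rewrite E normrM normrM normrN (ger0_norm (ler0n R 2)).
  have := normr_ge0 (sin (pi * (x + y))); nra.
have H1 := H p q dp dq gpq; have H2 := H p r dp dr gpr.
have : `|sin (pi * (q - r))| <= `|sin (pi * (p + q))| + `|sin (pi * (p + r))|.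
  rewrite (_ : pi * (q - r) = pi * (p + q) - pi * (p + r)); last by ring.
  rewrite sinB; apply: le_trans (ler_normB _ _) _; rewrite !normrM.
  by apply: lerD; rewrite ?ler_piMr ?ler_piMl ?cos_max.
nra.
Qed.

Lemma pairwise_separation (R : realType) (P : seq R) :
  pairwise (fun p q => p - q \isn't a Num.int) P ->
  exists2 g : R, 0 < g & pairwise (fun p q => g <= `|sin (pi * (p - q))|) P.
Proof.
elim: P => [|p P IH] /=; first by exists 1.
move=> /andP[pP /IH[g g0 gP]].
have [g' g'0 g'P] : exists2 g' : R, 0 < g' &
    all (fun q => g' <= `|sin (pi * (p - q))|) P.
  elim: P pP {IH gP} => [|q P IH] /=; first by exists 1.
  move=> /andP[/sinpi_neq0 pq /IH[h h0 hP]].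
  exists (Num.min h `|sin (pi * (p - q))|).
    by rewrite lt_min h0 normr_gt0.
  rewrite ge_min lexx orbT /=; apply: sub_all hP => x hx.
  by rewrite ge_min hx.
exists (Num.min g g'); first by rewrite lt_min g0.
apply/andP; split.
  by apply: sub_all g'P => x gx; rewrite ge_min gx orbT.
by apply: sub_pairwise gP => x y gx; rewrite ge_min gx.
Qed.

Lemma sum_indicator (R : realType) (P : seq R) (a : pred R) :
  \sum_(p <- P) (a p)%:R = (count a P)%:R :> R.
Proof. by elim: P => [|p P IH]; rewrite ?big_nil// big_cons IH -natrD. Qed.

Lemma escapes_concentration (R : realType) (u : nat -> R) (e : R) :
  escapes u -> 0 < e ->
  exists2 d : R, 0 < d & exists n1, forall n (k z0 : R), (n1 <= n)%N ->
    Ex u n (fun z => (`|cos (2 * pi * (z - z0)) - k| <= d)%R%:R) <= e.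
Proof.
move=> uesc e0.
have [k Hk] := expr_gt_near (2 / e) (ltr1n R 2).
have {}Hk := Hk _ (leqnn k).
have [P [n1 [/pairwise_separation[g g0 Pg] HP]]] := escapes_spread k uesc.
(* Here [2 * d] is less than [g ^+ 2], so by [cos_three_points] at most two points of each translate
   of [P] are counted. *)
exists (g ^+ 2 / 4); first by rewrite divr_gt0// exprn_gt0.
exists n1 => n x z0 n1n.
apply: (@le_trans _ _ (2 / 2 ^+ k)).
  apply: HP => // v.
  pose a := fun p => `|cos (2 * pi * (v + p - z0)) - x| <= g ^+ 2 / 4.
  rewrite (sum_indicator P a) ler_nat -size_filter.
  have := filter_all a P; have := pairwise_filter a Pg.
  case: (seq.filter a P) => [|p [|q [|r s]]]//= /andP[/and3P[pq pr _]] /andP[/andP[qr _] _].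
  move=> /and4P[ap aq ar _]; exfalso.
  have E s1 s2 : s1 - s2 = (v + s1 - z0) - (v + s2 - z0) by ring.
  rewrite E in pq; rewrite E in pr; rewrite E in qr.
  have := cos_three_points g0 pq pr qr ap aq ar.
  have := exprn_gt0 2 g0; lra.
by rewrite ler_pdivrMr ?exprn_gt0// mulrC -ler_pdivrMr// ltW.
Qed.

Lemma cvg_uniform_approx (R : realType) (f : nat -> R) :
  (forall e, 0 < e -> exists2 g : nat -> R, cvg (g @ \oo) &
     exists n1, forall n, (n1 <= n)%N -> `|f n - g n| <= e) ->
  cvg (f @ \oo).
Proof.
move=> H; apply/cauchy_cvgP/cauchy_exP => e e0.
have e30 : 0 < e / 3 by lra.
have [g /cvg_ex[l gl] [n1 fg]] := H _ e30.
exists l; move/cvgrPdist_le : gl => /(_ _ e30)[n2 _ gl].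
exists (maxn n1 n2) => // n /=; rewrite geq_max => /andP[n1n n2n].
have := gl n n2n; have := fg n n1n; rewrite -ball_normE /=.
have := ler_distD (g n) l (f n); rewrite (distrC (g n)); lra.
Qed.

(** Turns membership in an arc of length [w] around the integers into a threshold for a cosine. *)
Lemma cos_arc (R : realType) (w x : R) (N : int) : 0 < w < 1 ->
  (`|x - N%:~R| <= w / 2 -> cos (pi * w) <= cos (2 * pi * x)) /\
  (w / 2 <= x - N%:~R <= 1 - w / 2 -> cos (2 * pi * x) <= cos (pi * w)).
Proof.
move=> /andP[w0 w1].
have p0 : 0 < pi :> R := pi_gt0 R.
have E : cos (2 * pi * x) = cos (2 * pi * (x - N%:~R)).
  by rewrite -[RHS](cosD2piz _ N); congr cos; ring.
rewrite E; move: (x - N%:~R) => y {x E}.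
split => [yw|/andP[yw wy]].
  rewrite -(cos_norm (2 * pi * y)) normrM gtr0_norm ?mulr_gt0//.
  have := normr_ge0 y => y0.
  by rewrite leNgt ltr_cos -?leNgt ?in_itv /=; nra.
have [y2|y2] := leP y (1 / 2).
  by rewrite leNgt ltr_cos -?leNgt ?in_itv /=; nra.
have -> : cos (2 * pi * y) = cos (2 * pi * (1 - y)).
  by rewrite -(cosN (2 * pi * y)) -(cosD2piz _ 1); congr cos; ring.
by rewrite leNgt ltr_cos -?leNgt ?in_itv /=; nra.
Qed.

Lemma Ex_ceil_eq_cvg (R : realType) (a c s t : R) : 1 < a -> c != 0 ->
  escapes (fun i => c * a ^+ i) ->
  cvg ((fun n => Ex (fun i => c * a ^+ i) n
     (fun z => (Num.ceil (s + z) == Num.ceil (t + z))%:R)) @ \oo).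
Proof.
move=> a1 c0 uesc; pose u i := c * a ^+ i.
have E : (fun z => (Num.ceil (s + z) == Num.ceil (t + z))%:R : R) =
         (fun z => (Num.ceil (t + z) == Num.ceil (s + z))%:R : R).
  by apply/funext => z; rewrite eq_sym.
wlog st : s t E / s <= t.
  move=> H; have [st|/ltW ts] := leP s t; first exact: H.
  by rewrite E; apply: H.
move=> {E}; have [w1|w1] := leP 1 (t - s).
  rewrite (_ : (fun _ => _) = cst 0); first exact: is_cvg_cst.
  apply/funext => n; rewrite -[RHS](Ex_cst u n); apply: eq_Ex => z.
  case: eqP => // szt; exfalso.
  have := ceil_itv (s + z); have := ceil_itv (t + z); rewrite szt intrD.
  by move=> /andP[_ ?] /andP[? _]; lra.
have [stE|st_neq] := eqVneq s t.
  rewrite (_ : (fun _ => _) = cst 1); first exact: is_cvg_cst.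
  by apply/funext => n; rewrite -[RHS](Ex_cst u n); apply: eq_Ex => z; rewrite stE eqxx.
pose w := t - s; have w0 : 0 < w by rewrite subr_gt0 lt_neqAle st_neq.
have w01 : 0 < w < 1 by rewrite w0.
(* The ceilings differ exactly when an integer lies in [s + z, t + z), an interval of midpoint
   [z - z0] and length [w]. *)
pose z0 := - ((s + t) / 2); pose k := cos (pi * w).
pose F z : R := (Num.ceil (s + z) == Num.ceil (t + z))%:R.
have FP z : (F z = 1 /\ cos (2 * pi * (z - z0)) <= k) \/
            (F z = 0 /\ k <= cos (2 * pi * (z - z0))).
  have := ceil_itv (s + z); have := ceil_itv (t + z).
  rewrite /F; set Nt := Num.ceil (t + z); set Ns := Num.ceil (s + z).
  rewrite !intrD => /andP[t1 t2] /andP[s1 s2]; case: eqP => NN /=.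
    left; split => //; apply: (cos_arc (z - z0) (Ns - 1) w01).2.
    by rewrite intrB /z0 /w; rewrite -NN in t1 t2; apply/andP; split; lra.
  right; split => //; apply: (cos_arc (z - z0) Ns w01).1.
  have NsNt : (Ns + 1 <= Nt)%R.
    have : (Ns <= Nt)%R by rewrite /Ns /Nt ceil_le// lerD2r.
    by move: NN; lia.
  have : Ns%:~R + 1 <= Nt%:~R :> R by rewrite -[1]/(1%:~R) -intrD ler_int.
  by rewrite ler_norml /z0 /w => ?; apply/andP; split; lra.
have p0 : 0 < pi :> R := pi_gt0 R.
have k1 : k < 1 by rewrite -cos0 ltr_cos ?in_itv /=; nra.
have kN1 : -1 < k by rewrite -cospi ltr_cos ?in_itv /=; nra.
(* The image of the threshold [k] under the affine map taking the cosine into [0, 1]; the map halves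
   distances, hence [d / 2] below. *)
pose T := (1 - k) / 2.
have T01 : 0 < T < 1 by rewrite /T; apply/andP; split; lra.
apply: cvg_uniform_approx => e e0.
have e20 : 0 < e / 2 by lra.
have [d d0 [n1 Hd]] := escapes_concentration uesc e20.
have d20 : 0 < d / 2 by lra.
have [m [M HM]] := step_approx T01 d20 e20.
pose S z := (1 - cos (2 * pi * (z - z0))) / 2.
pose G z := 1 - (1 - S z ^+ m) ^+ M.
exists (fun n => Ex u n G).
  apply: trig_cvg => //.
  have tS : trig S.
    rewrite (_ : S = fun z => 1 / 2 +
       (- 1 / 2) * cos (2 * pi * 1%:~R * z + - (2 * pi * z0))).
      by apply: trig_add; [exact: trig_cst|exact: trig_cos].
    apply/funext => z; rewrite /S mulr1 (_ : 2 * pi * z + - (2 * pi * z0) = 2 * pi * (z - z0)); last by ring.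
    by field.
  have tB f : trig f -> trig (fun z => 1 - f z).
    move=> tf; rewrite (_ : (fun _ => _) = (fun z => 1 + (-1) * f z)).
      apply: trig_add; first exact: trig_cst.
      by apply: trigM => //; exact: trig_cst.
    by apply/funext => z; ring.
  by apply/tB/trigX/tB/trigX.
exists n1 => n n1n; rewrite -/F -ExB.
pose I z : R := (`|cos (2 * pi * (z - z0)) - k| <= d)%R%:R.
have FGI z : `|F z - G z| <= e / 2 + I z.
  have S01 : 0 <= S z <= 1.
    have := cos_le1 (2 * pi * (z - z0)); have := cos_geN1 (2 * pi * (z - z0)).
    by rewrite /S => ? ?; apply/andP; split; lra.
  have [/andP[p1 p2] H1 H2] := HM _ S01; rewrite /G /I.
  have [cd|] := boolP (`|cos (2 * pi * (z - z0)) - k| <= d).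
    rewrite /=; have F01 : 0 <= F z <= 1 by rewrite /F; case: eqP => /=; rewrite ?ler01 ?lexx.
    move: F01 => /andP[? ?].
    by rewrite ler_norml; apply/andP; split; lra.
  rewrite ler_norml negb_and -!ltNge /= addr0 => cd.
  case: (FP z) => -[-> ck].
    have : T + d / 2 <= S z by rewrite /T /S; case/orP: cd; lra.
    by move=> /H2 H; rewrite ler_norml; apply/andP; split; lra.
  have : S z <= T - d / 2 by rewrite /T /S; case/orP: cd; lra.
  by move=> /H1 H; rewrite ler_norml; apply/andP; split; lra.
have EI : Ex u n I <= e / 2 by exact: Hd.
have EE : Ex u n (fun z => e / 2 + I z) <= e by rewrite ExD Ex_cst; lra.
rewrite ler_norml; apply/andP; split.
  rewrite lerNl -mulN1r -ExZ; apply: le_trans EE; apply: le_Ex => z.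
  by have := FGI z; rewrite ler_norml mulN1r => /andP[? ?]; lra.
apply: le_trans EE; apply: le_Ex => z.
by have := FGI z; rewrite ler_norml => /andP[? ?]; lra.
Qed.

(** * Pairs of words *)

Lemma big_tuple_rcons (V : nmodType) n (F : n.+1.-tuple bool -> V) :
  \sum_x F x = \sum_(x : n.-tuple bool) \sum_(b : bool) F (rcons_tuple x b).
Proof.
rewrite pair_big /=.
rewrite (reindex (fun p : n.-tuple bool * bool => rcons_tuple p.1 p.2))//=.
apply: onW_bij; apply: inj_card_bij => [[x b] [y c] /(congr1 val)/rcons_inj[/val_inj -> -> //]|].
by rewrite card_prod !card_tuple card_bool expnSr.
Qed.

Lemma tnth_rcons_widen n (x : n.-tuple bool) b (i : 'I_n) :
  tnth (rcons_tuple x b) (widen_ord (leqnSn n) i) = tnth x i.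
Proof. by rewrite !(tnth_nth false) /= nth_rcons size_tuple ltn_ord. Qed.

Lemma tnth_rcons_max n (x : n.-tuple bool) b :
  tnth (rcons_tuple x b) ord_max = b.
Proof. by rewrite (tnth_nth false) /= nth_rcons size_tuple ltnn eqxx. Qed.

Lemma hamming_dist_sum n (x y : n.-tuple bool) :
  hamming_dist x y = (\sum_(i < n) (tnth x i != tnth y i))%N.
Proof. by rewrite /hamming_dist -sum1dep_card big_mkcond; apply: eq_bigr => i _; case: ifP. Qed.

Lemma hamming_dist_rcons n (x y : n.-tuple bool) b c :
  hamming_dist (rcons_tuple x b) (rcons_tuple y c) = (hamming_dist x y + (b != c))%N.
Proof.
rewrite !hamming_dist_sum big_ord_recr /= !tnth_rcons_max; congr (_ + _)%N.
by apply: eq_bigr => i _; rewrite !tnth_rcons_widen.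
Qed.

Section WeightedPairs.
Variables (R : realType) (wt : nat -> R).

Definition ell n (x : n.-tuple bool) : R := \sum_(i < n) (tnth x i)%:R * wt i.

Lemma ell_rcons n (x : n.-tuple bool) b :
  ell (rcons_tuple x b) = ell x + b%:R * wt n.
Proof.
rewrite /ell big_ord_recr /= tnth_rcons_max; congr (_ + _).
by apply: eq_bigr => i _; rewrite tnth_rcons_widen.
Qed.

(** The function [f] is left arbitrary so that a common last bit can be absorbed into it by
    [avg]. *)
Definition pair_mean n d (f : R -> R -> R) : R :=
  2 ^- n * \sum_(x : n.-tuple bool) \sum_(y : n.-tuple bool)
    (hamming_dist x y == d)%:R * f (ell x) (ell y).

Definition avg (w : R) (f : R -> R -> R) (p q : R) : R := (f p q + f (p + w) (q + w)) / 2.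

(** Equal last bits keep the distance and translate both sums together; distinct last bits leave
    prefixes at distance [d]. *)
Lemma pair_meanS n d f : pair_mean n.+1 d.+1 f = pair_mean n d.+1 (avg (wt n) f) +
  2 ^- n.+1 * \sum_(x : n.-tuple bool) \sum_(y : n.-tuple bool)
    (hamming_dist x y == d)%:R *
       (f (ell x + wt n) (ell y) + f (ell x) (ell y + wt n)).
Proof.
have -> : pair_mean n d.+1 (avg (wt n) f) =
   2 ^- n.+1 * \sum_(x : n.-tuple bool) \sum_(y : n.-tuple bool)
    (hamming_dist x y == d.+1)%:R * (f (ell x) (ell y) + f (ell x + wt n) (ell y + wt n)).
  rewrite /pair_mean exprSr invfM -mulrA; congr (_ * _); rewrite mulr_sumr.
  apply: eq_bigr => x _; rewrite mulr_sumr; apply: eq_bigr => y _.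
  by rewrite /avg; ring.
rewrite /pair_mean -mulrDr -big_split big_tuple_rcons; congr (_ * _).
apply: eq_bigr => x _; rewrite -big_split exchange_big big_tuple_rcons /=.
apply: eq_bigr => y _.
rewrite !big_bool /= !hamming_dist_rcons !ell_rcons !mul0r !mul1r !addr0 !addn0 !addn1 !eqSS.
by ring.
Qed.

(* By the gap hypothesis, the words of a contributing pair agree from position
   [K] on, so the remaining bits act as a common random translation. *)
Lemma pair_mean_Ex K d f :
  (forall n (x y : n.-tuple bool), (K <= n)%N -> hamming_dist x y = d ->
     1 <= `|ell x + wt n - ell y|) ->
  (forall p q, 1 <= `|p - q| -> f p q = 0) ->
  forall l, pair_mean (K + l) d.+1 f = 2 ^- K *
    \sum_(x : K.-tuple bool) \sum_(y : K.-tuple bool) (hamming_dist x y == d.+1)%:R *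
      Ex (fun i => wt (K + i)) l (fun z => f (ell x + z) (ell y + z)).
Proof.
move=> gap f0 l; elim: l f f0 => [|l IH] f f0.
  rewrite addn0 /pair_mean; congr (_ * _); apply: eq_bigr => x _.
  by apply: eq_bigr => y _ /=; rewrite !addr0.
(* Pairs with distinct last bits contribute nothing: [gap] applies to the prefixes in either
   order. *)
rewrite addnS pair_meanS big1 ?mulr0 ?addr0 => [|x _]; last first.
  rewrite big1// => y _; case: eqP => [xy|]; last by rewrite mul0r.
  rewrite !f0 ?addr0 ?mulr0//; last by apply: gap => //; rewrite leq_addr.
  rewrite distrC; apply: gap; first by rewrite leq_addr.
  by rewrite -xy !hamming_dist_sum; apply: eq_bigr => i _; rewrite eq_sym.
rewrite IH; last first.
  move=> p q pq; rewrite /avg !f0 ?addr0 ?mul0r//.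
  by rewrite opprD addrACA subrr addr0.
congr (_ * _); apply: eq_bigr => x _; apply: eq_bigr => y _ /=; congr (_ * _).
by apply: eq_Ex => z; rewrite /avg !addrA.
Qed.

Lemma le_pair_mean n d f g : (forall p q, f p q <= g p q) ->
  pair_mean n d f <= pair_mean n d g.
Proof.
move=> fg; rewrite /pair_mean ler_wpM2l ?invr_ge0 ?exprn_ge0//.
by apply: ler_sum => x _; apply: ler_sum => y _; rewrite ler_wpM2l.
Qed.

Lemma ell_sub_dist2 n (x y : n.-tuple bool) : hamming_dist x y = 2 ->
  exists i j : nat, exists b c : bool, [/\ (i < j)%N, (j < n)%N &
    ell x - ell y = (-1) ^+ b * wt i + (-1) ^+ c * wt j].
Proof.
move=> /eqP/cards2P[i [j [ij xyE]]].
have xy l : (tnth x l != tnth y l) = (l == i) || (l == j).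
  by have := in_set2 l i j; rewrite -xyE inE.
have E : ell x - ell y = (-1) ^+ tnth y i * wt i + (-1) ^+ tnth y j * wt j.
  have dE l : tnth x l != tnth y l ->
      (tnth x l)%:R * wt l - (tnth y l)%:R * wt l = (-1) ^+ tnth y l * wt l.
    by case: (tnth x l) (tnth y l) => -[]//= _; rewrite ?expr0 ?expr1; ring.
  rewrite /ell -sumrB (bigD1 i)//= (bigD1 j)/=; last by rewrite eq_sym.
  rewrite big1 ?addr0 => [|l /andP[li lj]].
    by rewrite !dE// xy eqxx ?orbT.
  have := xy l; rewrite (negbTE li) (negbTE lj) => /negbT; rewrite negbK => /eqP ->.
  by rewrite subrr.
have := ij; rewrite -val_eqE /= neq_ltn => /orP[ij'|ji'].
  by exists i, j, (tnth y i), (tnth y j); split.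
by exists j, i, (tnth y j), (tnth y i); split; rewrite // E addrC.
Qed.

End WeightedPairs.

(** * Gap between signed sums of three powers *)

Lemma uniform_threshold (P : nat -> nat -> Prop) N :
  (forall p, (p < N)%N -> exists K, forall k, (K <= k)%N -> P p k) ->
  exists K, forall p k, (p < N)%N -> (K <= k)%N -> P p k.
Proof.
elim: N => [|N IH] H; first by exists 0%N.
have [K1 H1] := IH (fun p pN => H p (ltnW pN)).
have [K2 H2] := H N (ltnSn N).
exists (maxn K1 K2) => p k; rewrite ltnS leq_eqVlt geq_max => /orP[/eqP ->|pN] /andP[k1 k2].
  exact: H2.
exact: H1.
Qed.

(** The delicate signs give a^i (a^q - a^p - 1) with p = j - i and q = k - i. For large q the top
    power dominates; for the finitely many other (p, q) the second factor is nonzero, and a^i = a^(k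
    - q) grows with k. *)
Lemma three_power_gap (R : realType) (a C : R) : 1 < a ->
  (forall p q, (0 < p < q)%N -> a ^+ q - a ^+ p - 1 != 0) ->
  exists K, forall i j k (b c : bool), (K <= k)%N -> (i < j)%N -> (j < k)%N ->
    C <= `|(-1) ^+ b * a ^+ i + (-1) ^+ c * a ^+ j + a ^+ k|.
Proof.
move=> a1 ne0; have a0 : 0 < a by lra.
pose d := 1 - a^-1.
have d0 : 0 < d by rewrite subr_gt0 invf_lt1.
have ax0 n : 0 < a ^+ n by rewrite exprn_gt0.
have [q0 Hq0] := expr_gt_near (2 / d) a1.
have [K0 HK0] := expr_gt_near (2 * C / d) a1.
have [K1 HK1] := expr_gt_near C a1.
have [K2 HK2] : exists K, forall q k, (q < q0)%N -> (K <= k)%N ->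
    forall p, (p < q0)%N -> (0 < p < q)%N ->
      C <= a ^+ (k - q) * `|a ^+ q - a ^+ p - 1|.
  apply: uniform_threshold => q _.
  have [K HK] : exists K, forall p k, (p < q0)%N -> (K <= k)%N -> (0 < p < q)%N ->
      C <= a ^+ (k - q) * `|a ^+ q - a ^+ p - 1|.
    apply: uniform_threshold => p _.
    have [pq|npq] := boolP (0 < p < q)%N; last by exists 0%N.
    have g0 : 0 < `|a ^+ q - a ^+ p - 1| by rewrite normr_gt0 ne0.
    have [K HK] := expr_gt_near (C / `|a ^+ q - a ^+ p - 1|) a1.
    exists (K + q)%N => k Kk _; rewrite -ler_pdivrMr// ltW// HK//.
    by rewrite leq_subRL ?(leq_trans _ Kk) ?leq_addl// addnC.
  by exists K => k Kk p pq0; exact: HK.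
exists (maxn K0 (maxn K1 K2)) => i j k b c.
rewrite !geq_max => /and3P[k0 k1 k2] ij jk.
have aij : a ^+ i <= a ^+ j by rewrite ler_eXn2l// ltnW.
have ai0 := ax0 i; have aj0 := ax0 j; have ak0 := ax0 k.
have akd : a ^+ k * d <= a ^+ k - a ^+ j.
  have : a ^+ j <= a ^+ k * a^-1.
    by case: k jk {k0 k1 k2 ak0} => // k jk; rewrite exprSr mulfK ?gt_eqF// ler_eXn2l.
  by rewrite /d; lra.
have Cd : 2 * C <= a ^+ k * d by rewrite -ler_pdivrMr// ltW// HK0.
have akd0 : 0 < a ^+ k * d by rewrite mulr_gt0.
case: c; rewrite ?expr0 ?expr1 ?mul1r ?mulN1r; last first.
  apply: le_trans (ler_norm _); have := HK1 _ k1.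
  by case: b; rewrite ?expr0 ?expr1 ?mul1r ?mulN1r; lra.
case: b; rewrite ?expr0 ?expr1 ?mul1r ?mulN1r; last first.
  by apply: le_trans (ler_norm _); lra.
pose q := (k - i)%N; pose p := (j - i)%N.
have pq : (0 < p < q)%N by rewrite /p /q; lia.
have kE : a ^+ k = a ^+ i * a ^+ q by rewrite -exprD /q subnKC//; lia.
have [qq0|qq0] := ltnP q q0.
  have := HK2 q k qq0 k2 p (ltn_trans (andP pq).2 qq0) pq.
  rewrite (_ : (k - q)%N = i); last by rewrite /q; lia.
  rewrite -[X in X * _]gtr0_norm// -normrM.
  rewrite (_ : a ^+ i * (a ^+ q - a ^+ p - 1) = - a ^+ i - a ^+ j + a ^+ k)//.
  have -> : a ^+ j = a ^+ i * a ^+ p by rewrite -exprD /p subnKC// ltnW.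
  by rewrite kE; ring.
apply: le_trans (ler_norm _).
have : 2 <= a ^+ q * d by rewrite -ler_pdivrMr// ltW// Hq0.
move=> H; have : 2 * a ^+ i <= a ^+ k * d by rewrite kE; nra.
lra.
Qed.

(** * Convergence of the spectrum at distance 3 when the equation has no solution *)

Definition oac_weight (R : realType) (a : R) (i : nat) : R := (1 - a^-1) * a ^+ i.+1.

Lemma powR_natr (R : realType) (r : R) k : 2 `^ (k%:R * r) = (2 `^ r) ^+ k.
Proof. by rewrite mulrC powRrM powR_mulrn// powR_ge0. Qed.

Lemma powR2_gt1 (R : realType) (r : R) : 0 < r -> 1 < 2 `^ r.
Proof.
move=> r0; have : 2 `^ 0 <= 2 `^ r :> R by apply: ler_powR; rewrite ?ler1n ?ltW.
rewrite powRr0 le_eqVlt => /orP[|//].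
move=> /eqP a1; exfalso; have : (2 `^ r) `^ r^-1 = 2 :> R.
  by rewrite -powRrM mulfV ?gt_eqF// powRr1.
by rewrite -a1 powR1; lra.
Qed.

Lemma oac_ellE (R : realType) (r : R) n (x : n.-tuple bool) :
  oac_ell r x = ell (oac_weight (2 `^ r)) x.
Proof.
rewrite /oac_ell /ell mulr_sumr; apply: eq_bigr => i _.
by rewrite powR_natr powRN /oac_weight; ring.
Qed.

Lemma hds_nE (R : realType) (r : R) d n : hds_n r d n =
  pair_mean (oac_weight (2 `^ r)) n d (fun p q => (Num.ceil p == Num.ceil q)%:R).
Proof.
rewrite /hds_n /pair_mean; congr (_ * _); apply: eq_bigr => x _.
rewrite /oac_k -sum1dep_card natr_sum big_mkcond; apply: eq_bigr => y _.
rewrite /oac_m !oac_ellE eq_sym.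
by case: eqP; case: eqP => //= _ _; rewrite ?mulr1 ?mulr0 ?mul0r.
Qed.

Lemma is_cvg_big_seq (R : realType) (I : Type) (s : seq I) (f : I -> nat -> R) :
  (forall i, cvg (f i @ \oo)) -> cvg ((fun n => \sum_(i <- s) f i n) @ \oo).
Proof.
move=> cf; elim: s => [|i s IH].
  rewrite (_ : (fun _ => _) = cst 0); first exact: is_cvg_cst.
  by apply/funext => n; rewrite big_nil.
rewrite (_ : (fun _ => _) = (fun n => f i n + \sum_(j <- s) f j n)).
  exact: is_cvgD.
by apply/funext => n; rewrite big_cons.
Qed.

Lemma Ex_int_weights (R : realType) (u : nat -> R) (f : R -> R) n :
  (forall i, u i \is a Num.int) -> (forall z w, w \is a Num.int -> f (z + w) = f z) ->
  Ex u n f = f 0.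
Proof.
move=> uint fper; elim: n => //= n IH.
rewrite -[RHS]IH; apply: eq_Ex => z.
by rewrite fper//; field.
Qed.

Lemma ceil_eq_int_periodic (R : realType) (s t z w : R) : w \is a Num.int ->
  (Num.ceil (s + (z + w)) == Num.ceil (t + (z + w))) =
  (Num.ceil (s + z) == Num.ceil (t + z)).
Proof.
by move=> wint; rewrite !addrA ![Num.ceil (_ + w)]ceilDrz// (inj_eq (addIr _)).
Qed.

Lemma hds_n_cvg (R : realType) (r : R) : 0 < r ->
  (forall p q, (0 < p < q)%N -> (2 `^ r) ^+ q - (2 `^ r) ^+ p - 1 != 0) ->
  cvg (hds_n r 3 @ \oo).
Proof.
move=> r0 nsol; set a := 2 `^ r in nsol *.
have a1 : 1 < a := powR2_gt1 r0.
have l0 : 0 < 1 - a^-1 by rewrite subr_gt0 invf_lt1//; apply: lt_trans a1.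
(* The constant offsets the factor [1 - a^-1] of the weights, so that the gap becomes 1. *)
have [K HK] := three_power_gap (1 - a^-1)^-1 a1 nsol.
have gap n (x y : n.-tuple bool) : (K <= n)%N -> hamming_dist x y = 2%N ->
    1 <= `|ell (oac_weight a) x + oac_weight a n - ell (oac_weight a) y|.
  move=> Kn /(ell_sub_dist2 (oac_weight a))[i [j [b [c [ij jn E]]]]].
  rewrite addrAC E /oac_weight.
  rewrite (_ : (-1) ^+ b * _ + (-1) ^+ c * _ + _ = (1 - a^-1) * ((-1) ^+ b * a ^+ i.+1 + (-1) ^+ c * a ^+ j.+1 + a ^+ n.+1)); last by ring.
  rewrite normrM gtr0_norm// -ler_pdivrMl// mulr1.
  by apply: HK => //; rewrite leqW.
have ceil0 (p q : R) : 1 <= `|p - q| -> (Num.ceil p == Num.ceil q)%:R = 0 :> R.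
  move=> pq; case: eqP => // cpq; exfalso.
  have := ceil_itv p; have := ceil_itv q; rewrite cpq intrB => /andP[q1 q2] /andP[p1 p2].
  by move: pq; rewrite leNgt ltr_norml; move/negP; apply; apply/andP; split; lra.
have ExC (s t : R) : cvg ((fun l => Ex (fun i => oac_weight a (K + i)) l
    (fun z => (Num.ceil (s + z) == Num.ceil (t + z))%:R)) @ \oo).
  have uE : (fun i => oac_weight a (K + i)) = (fun i => ((1 - a^-1) * a ^+ K.+1) * a ^+ i).
    by apply/funext => i; rewrite /oac_weight -addSn exprD mulrA.
  have c0 : (1 - a^-1) * a ^+ K.+1 != 0.
    by rewrite mulf_neq0 ?expf_neq0// gt_eqF//; apply: lt_trans a1.
  have [esc|[k ak]] := geometric_escapes a1 c0.
    by rewrite uE; exact: Ex_ceil_eq_cvg.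
  rewrite (_ : (fun _ => _) = cst (Num.ceil (s + 0) == Num.ceil (t + 0))%:R).
    exact: is_cvg_cst.
  apply/funext => l; rewrite (Ex_int_weights (f :=
     fun z => (Num.ceil (s + z) == Num.ceil (t + z))%:R))// => [i|z w wint].
    rewrite /oac_weight; have a0 : a != 0 by rewrite gt_eqF//; apply: lt_trans a1.
    rewrite (_ : _ * _ = a ^+ (K + i).+1 - a ^+ (K + i)); last first.
      by rewrite exprS; field.
    by rewrite ak rpredB// rpredX// intr_int.
  by rewrite ceil_eq_int_periodic.
have : cvg ((fun l => hds_n r 3 (l + K)) @ \oo).
  rewrite (_ : (fun _ => _) = (fun l => 2 ^- K *
    \sum_(x : K.-tuple bool) \sum_(y : K.-tuple bool) (hamming_dist x y == 3)%:R *
      Ex (fun i => oac_weight a (K + i)) l (fun z =>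
        (Num.ceil (ell (oac_weight a) x + z) == Num.ceil (ell (oac_weight a) y + z))%:R))).
    apply: is_cvgM; first exact: is_cvg_cst.
    apply: is_cvg_big_seq => x; apply: is_cvg_big_seq => y.
    by apply: is_cvgM; [exact: is_cvg_cst|exact: ExC].
  apply/funext => l; rewrite hds_nE addnC.
  exact: (pair_mean_Ex gap ceil0).
move=> /cvg_ex[l Hl]; apply/cvg_ex; exists l.
by rewrite -(cvg_shiftn K).
Qed.

(** * Linear growth when the equation has a solution *)

Lemma ler_sum_image (R : realType) (I J : finType) (h : I -> J) (G : J -> R) :
  injective h -> (forall j, 0 <= G j) -> \sum_i G (h i) <= \sum_j G j.
Proof.
move=> hinj G0; rewrite -(big_imset G (A := predT))/=; last exact: in2W.
by rewrite big_mkcond; apply: ler_sum => j _; case: ifP.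
Qed.

Lemma sum_delta (R : realType) (f : nat -> R) n m : (m < n)%N ->
  \sum_(i < n) ((i : nat) == m)%:R * f i = f m.
Proof.
move=> mn; rewrite (bigD1 (Ordinal mn))//= eqxx mul1r big1 ?addr0// => i.
by rewrite -val_eqE /= => /negbTE ->; rewrite mul0r.
Qed.

(** Equality of the sums survives a common last bit, so the earlier contribution persists; each new
    position [m + q] adds at least 2^m pairs, one for each prefix of length [m], of weight 2^-(m + q
    + 1). *)
Lemma pair_mean_eq_ge (R : realType) (wt : nat -> R) p q m : (0 < p < q)%N ->
  (forall i, wt (i + q)%N = wt (i + p)%N + wt i) ->
  m%:R / 2 ^+ q.+1 <= pair_mean wt (m + q) 3 (fun s t => (s == t)%:R).
Proof.
move=> pq wtq; elim: m => [|m IH].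
  rewrite mul0r mulr_ge0 ?invr_ge0 ?exprn_ge0// sumr_ge0// => x _.
  by rewrite sumr_ge0// => y _; rewrite mulr_ge0.
rewrite addSn pair_meanS -natr1 mulrDl; apply: lerD.
  apply: le_trans IH _; apply: le_pair_mean => s t.
  by rewrite /avg (inj_eq (addIr _)); case: eqP => _ /=; lra.
rewrite mul1r (_ : (2 ^+ q.+1)^-1 = 2 ^- (m + q).+1 * 2 ^+ m :> R); last first.
  by rewrite -addnS exprD invfM -mulrA mulrCA mulVf ?mulr1// expf_neq0.
rewrite ler_wpM2l ?invr_ge0 ?exprn_ge0//.
(* Prefix [e] followed by zeros, and the same with ones at [m] and [m + p]:
   adding a final one to the former makes the weighted sums equal. *)
pose X (e : m.-tuple bool) : (m + q).-tuple bool := [tuple nth false e i | i < m + q].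
pose Y (e : m.-tuple bool) : (m + q).-tuple bool :=
  [tuple nth false e i || (((i : nat) == m) || ((i : nat) == m + p)%N) | i < m + q].
pose H (z : (m + q).-tuple bool * (m + q).-tuple bool) : R :=
  (hamming_dist z.1 z.2 == 2%N)%:R *
   ((ell wt z.1 + wt (m + q)%N == ell wt z.2)%:R + (ell wt z.1 == ell wt z.2 + wt (m + q)%N)%:R).
rewrite (pair_big predT predT (fun x y => H (x, y))) /=.
apply: (@le_trans _ _ (\sum_(e : m.-tuple bool) H (X e, Y e))); last first.
  rewrite (eq_bigr H) => [|[]//]; apply: (ler_sum_image (h := fun e => (X e, Y e))).
    move=> e e' /(congr1 fst) XE; apply: eq_from_tnth => i.
    have := congr1 (fun t => tnth t (lshift q i)) XE.
    by rewrite !tnth_mktuple /= -!tnth_nth.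
  by move=> z; rewrite mulr_ge0// addr_ge0.
have n0 (e : m.-tuple bool) k : (m <= k)%N -> nth false e k = false.
  by move=> mk; rewrite nth_default// size_tuple.
have mq : (m < m + q)%N by lia.
have mpq : (m + p < m + q)%N by lia.
have XY e (i : 'I_(m + q)) : tnth (Y e) i =
    tnth (X e) i || (((i : nat) == m) || ((i : nat) == m + p)%N).
  by rewrite !tnth_mktuple.
have X0 e (i : 'I_(m + q)) : ((i : nat) == m) || ((i : nat) == m + p)%N -> tnth (X e) i = false.
  by rewrite tnth_mktuple => /orP[]/eqP ->; rewrite n0// leq_addr.
have <- : \sum_(e : m.-tuple bool) 1 = 2 ^+ m :> R.
  by rewrite sumr_const card_tuple card_bool natrX.
apply: ler_sum => e _.
have hd2 : hamming_dist (X e) (Y e) = 2%N.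
  rewrite /hamming_dist (_ : [set _ | _]%SET = [set Ordinal mq; Ordinal mpq]%SET).
    by rewrite cards2 -val_eqE /= -[X in X != _]addn0 eqn_add2l eq_sym -lt0n (andP pq).1.
  apply/setP => i; rewrite !inE -!val_eqE /= XY.
  have := X0 e i; case: (_ || _) => [->//|_].
  by rewrite orbF eqxx.
have ellY : ell wt (Y e) = ell wt (X e) + wt (m + q)%N.
  rewrite wtq -(sum_delta wt mq) -(sum_delta wt mpq) addrA addrAC -!big_split /=.
  apply: eq_bigr => i _; rewrite XY -!mulrDl; congr (_ * _).
  have := X0 e i; case: eqP => [->|_] /=.
    move=> ->//=; have -> : (m == m + p)%N = false by lia.
    by rewrite addr0 add0r.
  by case: eqP => [_ ->//|_ _] /=; rewrite ?orbF ?addr0 ?add0r.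
by rewrite /H /= hd2 ellY !eqxx mul1r lerDl.
Qed.

Lemma hds_n_cvg_pinfty (R : realType) (r : R) (i j : nat) : (0 < i)%N -> (0 < j)%N ->
  2 `^ (i%:R * r) * (2 `^ (j%:R * r) - 1) = 1 -> hds_n r 3 @ \oo --> +oo.
Proof.
rewrite !powR_natr; set a := 2 `^ r => i0 j0 aij.
pose q := (i + j)%N; pose wt := oac_weight a.
have aq : a ^+ q = a ^+ i + 1 by move: aij; rewrite /q exprD; lra.
have iq : (0 < i < q)%N by rewrite /q; lia.
have {aij}wtq x : wt (x + q)%N = wt (x + i)%N + wt x.
  move: (q) aq => k aq; rewrite /wt /oac_weight -!addSn [a ^+ (x.+1 + k)]exprD aq.
  by rewrite exprD; ring.
apply/cvgryPge => A.
(* Any [m > m0] has [m%:R / 2 ^+ q.+1 >= A]. *)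
pose m0 := Num.truncn (A * 2 ^+ q.+1).
exists (m0.+1 + q)%N => // n /= mn.
have nE : n = (n - q + q)%N by rewrite subnK// (leq_trans _ mn)// leq_addl.
rewrite nE hds_nE; apply: le_trans (le_pair_mean wt _ _ (f := fun s t => (s == t)%:R) _).
  apply: le_trans (pair_mean_eq_ge (n - q) iq wtq).
  rewrite ler_pdivlMr ?exprn_gt0//; apply: le_trans (ltW (truncnS_gt _)) _.
  by rewrite ler_nat -(leq_add2r q) -nE.
by move=> s t /=; case: eqP => [->|_]; rewrite ?eqxx.
Qed.

Unset Implicit Arguments.

(** The rate is positive because at [r = 0] all words form one coset: psi(3;n) is then binomial(n,
    3), which diverges, although the equation has no solution. *)
Theorem theoremV3 (R : realType) (r : R) (hr0 : 0 < r) (hr1 : r <= 1) :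
  cvg ((hds_n r 3 n)%:E @[n --> \oo]) /\
  (~ (exists i j : nat, [/\ (1 <= i)%N, (1 <= j)%N &
        2 `^ (i%:R * r) * (2 `^ (j%:R * r) - 1) = 1]) ->
   (hds r 3 < +oo)%E) /\
  ((exists i j : nat, [/\ (1 <= i)%N, (1 <= j)%N &
        2 `^ (i%:R * r) * (2 `^ (j%:R * r) - 1) = 1]) ->
   hds r 3 = +oo%E).
Proof.
have infinite_case : (exists i j : nat, [/\ (1 <= i)%N, (1 <= j)%N &
    2 `^ (i%:R * r) * (2 `^ (j%:R * r) - 1) = 1]) ->
    (hds_n r 3 n)%:E @[n --> \oo] --> +oo%E.
  by move=> [i [j [i1 j1 /(hds_n_cvg_pinfty i1 j1)]]] ?; apply/cvgeryP.
have finite_case : ~ (exists i j : nat, [/\ (1 <= i)%N, (1 <= j)%N &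
    2 `^ (i%:R * r) * (2 `^ (j%:R * r) - 1) = 1]) ->
    exists l : R, (hds_n r 3 n)%:E @[n --> \oo] --> l%:E.
  move=> nsol; suff /cvg_ex[l Hl] : cvg (hds_n r 3 @ \oo).
    by exists l; apply: cvg_EFin => //; exact: nearW.
  apply: hds_n_cvg => // p q /andP[p0 pq]; apply/eqP => pqE; apply: nsol.
  exists p, (q - p)%N; split => //; first by rewrite subn_gt0.
  by rewrite !powR_natr mulrBr -exprD subnKC ?(ltnW pq)// mulr1; lra.
split; last split.
- have [/infinite_case H|/finite_case[l H]] := EM (exists i j : nat,
    [/\ (1 <= i)%N, (1 <= j)%N & 2 `^ (i%:R * r) * (2 `^ (j%:R * r) - 1) = 1]).
    by apply/cvg_ex; exists +oo%E.
  by apply/cvg_ex; exists l%:E.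
- by move=> /finite_case[l /cvg_lim H]; rewrite /hds H// ltry.
- by move=> /infinite_case/cvg_lim H; rewrite /hds H.
Qed.
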